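(* Let $f:\Pi\to\overline{\Pi}$ be analytic and let $\tau\in\mathbb{R}$. Let $\gamma:[0,\infty)\to\mathbb{R}^{\ge0}$ be monotone increasing and $O(t)$ as $t\to0$. If $f$ is $\gamma$-regular at $\tau$, then $f$ is $\gamma$-horocyclically continuous at $\tau$.
   Context: $\Pi$ is the open upper half plane in $\mathbb{C}$ and $\overline{\Pi}=\{z\in\mathbb{C}:\operatorname{Im}z\ge0\}$. For analytic $f:\Pi\to\overline{\Pi}$, the Nevanlinna measure $\mu_f$ is the positive Borel measure on $\mathbb{R}$ that is the weak limit (against compactly supported continuous functions) of the measures $\operatorname{Im}f(x+iy)\,dx$ as $y\to0^+$. ''$\gamma$ is $O(t)$ as $t\to0$'' means there are $k,\delta>0$ with $\gamma(t)\le kt$ for $0\le t<\delta$. $f$ is $\gamma$-regular at $\tau$ if there exists $C>0$ such that $\frac{1}{\gamma(C|t-\tau|)}$ (with $1/0=+\infty$) is integrable on a neighborhood of $\tau$ with respect to $\mu_f$. For $\lambda:[0,\infty)\to\mathbb{R}^{\ge0}$, the $\lambda$-Stolz region at $\tau$ (in $\Pi$) is $$S^\lambda_\tau=\{z\in\Pi:\ \text{there is } C>0 \text{ with } \operatorname{Im}z\ge\lambda(C)\ \text{and}\ |\operatorname{Re}z-\tau|\le C\}.$$ Write $\gamma_\alpha(t)=\gamma(\alpha t)$, let $B(\tau,r)$ be the disk of center $\tau$ and radius $r$, and let $f(\tau)$ denote the nontangential boundary value of $f$ at $\tau$. $f$ is $\gamma$-horocyclically continuous at $\tau$ if there is a fixed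 $\alpha>0$ such that for each $\beta>0$, $$\sup_{z\in S^{\beta\gamma_\alpha}_\tau\cap B(\tau,1/\beta)}|f(z)-f(\tau)|<\infty,$$ and moreover $$\lim_{\beta\to\infty}\ \sup_{z\in S^{\beta\gamma_\alpha}_\tau\cap B(\tau,1/\beta)}|f(z)-f(\tau)|=0.$$
   Formalization: The formal theorem additionally assumes that γ is not identically zero; for γ = 0 (allowed if ''monotone increasing'' is weak) the claim fails, e.g. f(z) = -1/(z-5), τ = 0, where the supremum for β = 1/10 is infinite. *)

(* Defs.v *)
From mathcomp Require Import all_boot all_order all_algebra.
From mathcomp Require Import all_classical all_reals all_analysis.
From mathcomp Require Export complex.

Set Implicit Arguments.
Unset Strict Implicit.
Unset Printing Implicit Defensive.

Import Order.TTheory GRing.Theory Num.Theory.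
Import numFieldNormedType.Exports.

Local Open Scope classical_set_scope.
Local Open Scope ring_scope.
Local Open Scope complex_scope.

Section Defs.
Context {R : realType}.

(* The real-valued modulus; the norm `|z| of R[i] is an element of R[i]. *)
Definition cmod (z : R[i]) : R := ComplexField.Normc.normc z.

Definition upper_half_plane : set R[i] := [set z | 0 < complex.Im z].

Definition closed_upper_half_plane : set R[i] := [set z | 0 <= complex.Im z].

Definition disk (tau : R) (r : R) : set R[i] := [set z | cmod (z - tau%:C) < r].

(* Analyticity on an open set, by local power series expansions.  The alias
   R[i]^o gives access to the topology of R[i] defined by its norm. *)
Definition analytic_on (D : set R[i]) (f : R[i] -> R[i]) : Prop :=
  forall z0, D z0 -> exists (a : nat -> R[i]) (r : R), 0 < r /\
    forall z, cmod (z - z0) < r ->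
      series (fun n => (a n * (z - z0) ^+ n : R[i]^o)) @ \oo
        --> (f z : R[i]^o).

(* Convergence is in \bar R.  Finiteness on compact sets makes the integrals
   of the test functions against mu meaningful. *)
Definition is_nevanlinna_measure (f : R[i] -> R[i])
    (mu : {measure set (measurableTypeR R) -> \bar R}) : Prop :=
  (forall K : set R, compact K -> (mu K < +oo)%E) /\
  forall phi : R -> R, continuous phi ->
    compact (closure [set x | phi x != 0]) ->
    (\int[lebesgue_measure]_x (phi x * complex.Im (f (x +i* y)))%:E)%E
      @[y --> 0^'+] --> (\int[mu]_x (phi x)%:E)%E.

(* On \bar R the library's inverse satisfies 0^-1 = +oo. *)
Definition regular_at (gamma : R -> R)
    (mu : {measure set (measurableTypeR R) -> \bar R}) (tau : R) : Prop :=
  exists2 C : R, 0 < C &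
  exists U : set R, [/\ nbhs tau U, measurable U &
    mu.-integrable U (fun t => ((gamma (C * `|t - tau|))%:E^-1)%E)].

Definition stolz (lambda : R -> R) (tau : R) : set R[i] :=
  [set z | upper_half_plane z /\
    exists C : R, [/\ 0 < C, lambda C <= complex.Im z &
                      `|complex.Re z - tau| <= C]].

Definition nontangential_limit (f : R[i] -> R[i]) (tau : R) (w : R[i]) : Prop :=
  forall M : R, 0 < M ->
    (f z : R[i]^o)
      @[z --> within [set z | upper_half_plane z /\
                              `|complex.Re z - tau| <= M * complex.Im z]
                     (nbhs (tau%:C : R[i]^o))]
      --> (w : R[i]^o).

Definition horocyclic_osc (gamma : R -> R) (f : R[i] -> R[i]) (tau : R)
    (w : R[i]) (alpha beta : R) : \bar R :=
  ereal_sup [set (cmod (f z - w))%:E | z in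
    stolz (fun t => beta * gamma (alpha * t)) tau `&` disk tau beta^-1].

(* The boundary value f(tau) is the witness w: its existence is part of the
   notion. *)
Definition horocyclically_continuous_at (gamma : R -> R) (f : R[i] -> R[i])
    (tau : R) : Prop :=
  exists w : R[i], nontangential_limit f tau w /\
    exists alpha : R, [/\ 0 < alpha,
      forall beta : R, 0 < beta ->
        (horocyclic_osc gamma f tau w alpha beta < +oo)%E &
      horocyclic_osc gamma f tau w alpha beta @[beta --> +oo%R] --> 0%E].

Definition monotone_increasing (gamma : R -> R) : Prop :=
  forall s t, 0 <= s -> s <= t -> gamma s <= gamma t.

Definition bigO_id_at0 (gamma : R -> R) : Prop :=
  exists k delta : R, [/\ 0 < k, 0 < delta &
    forall t, 0 <= t -> t < delta -> gamma t <= k * t].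

End Defs.

(* Main.v *)
Require Import Defs.
From mathcomp Require Import all_boot all_order all_algebra.
From mathcomp Require Import all_classical all_reals all_analysis.
From mathcomp Require Import measurable_realfun complex ring lra.

Set Implicit Arguments.
Unset Strict Implicit.
Unset Printing Implicit Defensive.

Import Order.TTheory GRing.Theory Num.Theory.
Import numFieldNormedType.Exports.

Local Open Scope classical_set_scope.
Local Open Scope ring_scope.
Local Open Scope complex_scope.

(** The idea.  Near [tau], write [f] as the Cauchy transform of its Nevanlinna
    measure [mu] on a short interval around [tau], plus a function that extends
    continuously to [tau].  Regularity makes [1 / gamma(C |t - tau|)], hence by
    the linear bound on [gamma] also [1 / |t - tau|], integrable with respect to
    [mu], so the Cauchy transform converges at [tau].  In the horocyclic region
    [|t - z| >= Im z >= beta gamma(alpha |Re z - tau|)], and the kernel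
    [1 / (t - z)] is dominated by [1 / (beta gamma(C |t - tau|))] when
    [|t - tau| < 2 |Re z - tau|], and by [2 / |t - tau|] otherwise.  As [beta]
    grows the first bound tends to 0 in L^1, while in the second case the
    variation of the kernel tends to 0 away from [tau]
    ([kernel_bound_horocyclic], [transform_estimate], [weight_small]).  Cones
    are treated in the same way ([kernel_bound_cone]).

    The local representation is obtained from Cauchy's formula rather than from
    the Nevanlinna representation.  On a square centred at [tau], consider
    [f(z + i eps)] in the upper half and its mirror image
    [conj f(conj z + i eps)] in the lower half.  Adding the two contour
    integrals, the real axis contributes [Im f(t + i eps) / (t - z)], and
    [mu] appears as [eps] tends to 0 ([contour_identity],
    [local_representation], [boundary_representation]).  The integral over the
    outer sides is Lipschitz in [z] near [tau], uniformly in [eps], provided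
    that the integrand is bounded on those sides.  This holds after
    multiplication by the polynomial [corner], which vanishes where the sides
    cross the real axis, since [f] grows at most like [1 / Im z] there
    ([upper_half_plane_growth], by a barrier and the maximum principle
    [max_principle]).

    Complex analysis enters through Goursat's theorem for rectangles ([goursat])
    and the maximum principle.  Both rest on Taylor expansions of low order at
    each point separately ([jet]), which come directly from the local power
    series ([analytic_jet]). *)

(** * The modulus of a complex number *)

Section Modulus.
Context {R : realType}.
Implicit Types (z w : R[i]) (x y : R).

Lemma cmod_ge0 z : 0 <= cmod z.
Proof. by case: z => a b; rewrite /cmod /= sqrtr_ge0. Qed.

Lemma cmod0 : cmod (0 : R[i]) = 0.
Proof. exact: ComplexField.Normc.normc0. Qed.

Lemma cmodM z w : cmod (z * w) = cmod z * cmod w.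
Proof. exact: ComplexField.Normc.normcM. Qed.

Lemma cmodV z : cmod z^-1 = (cmod z)^-1.
Proof. exact: ComplexField.Normc.normcV. Qed.

Lemma cmodN z : cmod (- z) = cmod z.
Proof. by case: z => a b; rewrite /cmod /= !sqrrN. Qed.

Lemma cmodB z w : cmod (z - w) = cmod (w - z).
Proof. by rewrite -cmodN opprB. Qed.

Lemma cmod_triangle z w : cmod (z + w) <= cmod z + cmod w.
Proof. exact: le_normcD. Qed.

Lemma cmod_triangleB z w : cmod (z - w) <= cmod z + cmod w.
Proof. by rewrite -(cmodN w); exact: cmod_triangle. Qed.

Lemma cmod_gt0 z : (0 < cmod z) = (z != 0).
Proof.
rewrite lt_def cmod_ge0 andbT; congr negb.
apply/eqP/eqP => [/ComplexField.Normc.eq0_normc //|->].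
exact: cmod0.
Qed.

Lemma cmod_conj z : cmod z^*%C = cmod z.
Proof. by case: z => a b; rewrite /cmod /= sqrrN. Qed.

Lemma cmod_real x : cmod x%:C = `|x|.
Proof. by rewrite /cmod /= expr0n /= addr0 sqrtr_sqr. Qed.

Lemma cmodi : cmod ('i%C : R[i]) = 1.
Proof. by rewrite /cmod /= expr0n /= add0r expr1n sqrtr1. Qed.

Lemma cmodX z n : cmod (z ^+ n) = cmod z ^+ n.
Proof.
elim: n => [|n IH]; last by rewrite !exprS cmodM IH.
by rewrite !expr0 cmod_real normr1.
Qed.

Lemma cmodRe z : `|complex.Re z| <= cmod z.
Proof.
case: z => a b; rewrite /cmod /= -sqrtr_sqr ler_wsqrtr //.
by rewrite lerDl sqr_ge0.
Qed.

Lemma cmodIm z : `|complex.Im z| <= cmod z.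
Proof.
case: z => a b; rewrite /cmod /= -sqrtr_sqr ler_wsqrtr //.
by rewrite lerDr sqr_ge0.
Qed.

Lemma cmod_le_ReIm z : cmod z <= `|complex.Re z| + `|complex.Im z|.
Proof.
rewrite [in leLHS](complexE z) (le_trans (cmod_triangle _ _)) //.
by rewrite cmodM cmodi mul1r !cmod_real.
Qed.

Lemma cmod_sqr z : cmod z ^+ 2 = complex.Re z ^+ 2 + complex.Im z ^+ 2.
Proof. by case: z => a b; rewrite /cmod /= sqr_sqrtr // addr_ge0 ?sqr_ge0. Qed.

Lemma cReD z w : complex.Re (z + w) = complex.Re z + complex.Re w.
Proof. by case: z w => [? ?] []. Qed.

Lemma cImD z w : complex.Im (z + w) = complex.Im z + complex.Im w.
Proof. by case: z w => [? ?] []. Qed.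

Lemma cReN z : complex.Re (- z) = - complex.Re z.
Proof. by case: z. Qed.

Lemma cImN z : complex.Im (- z) = - complex.Im z.
Proof. by case: z. Qed.

Lemma cReM z w : complex.Re (z * w) =
  complex.Re z * complex.Re w - complex.Im z * complex.Im w.
Proof. by case: z w => [? ?] []. Qed.

Lemma cImM z w : complex.Im (z * w) =
  complex.Re z * complex.Im w + complex.Im z * complex.Re w.
Proof. by case: z w => [? ?] []. Qed.

Lemma complex_eq z w :
  complex.Re z = complex.Re w -> complex.Im z = complex.Im w -> z = w.
Proof. by case: z w => [? ?] [] ? ? /= -> ->. Qed.

Lemma norm_cmod z : `|z| = (cmod z)%:C.
Proof. by rewrite normc_def; case: z. Qed.

End Modulus.

(** * Taylor expansions at a point *)

Section Jets.
Context {R : realType}.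
Implicit Types (f g : R[i] -> R[i]) (z w : R[i]).

(** Difference quotients iterated at the centre: [jet n f z] holds when [f] agrees
    near [z] with a polynomial up to an error O(|w - z|^n).  Nesting
    the quotients, in place of naming Taylor coefficients, makes the first
    difference quotient of [f] visibly one order less regular than [f]. *)
Fixpoint jet n f z : Prop :=
  match n with
  | 0 => exists M r : R, 0 < r /\ forall w, cmod (w - z) < r -> cmod (f w) <= M
  | m.+1 => exists f1, jet m f1 z /\
      exists r : R, 0 < r /\
        forall w, cmod (w - z) < r -> f w = f z + (w - z) * f1 w
  end.

Lemma jet_ext n f g z : (exists r : R, 0 < r /\
    forall w, cmod (w - z) < r -> f w = g w) -> jet n f z -> jet n g z.
Proof.
case: n => [|n] [r [r0 fg]].
  move=> [M [s [s0 fM]]]; exists M, (Num.min r s).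
  split=> [|w]; first by rewrite lt_min r0.
  by rewrite lt_min => /andP[wr ws]; rewrite -fg // fM.
move=> [f1 [f1n [s [s0 ff1]]]]; exists f1; split=> //; exists (Num.min r s).
split=> [|w]; first by rewrite lt_min r0.
rewrite lt_min => /andP[wr ws]; rewrite -(fg w wr) -(fg z); last first.
  by rewrite subrr cmod0.
exact: ff1.
Qed.

Lemma jetW0 n f z : jet n f z -> jet 0 f z.
Proof.
elim: n f => [//|n IH] f [f1 [/IH [M [r [r0 f1M]]] [s [s0 ff1]]]].
exists (cmod (f z) + r * M), (Num.min r s).
split=> [|w]; first by rewrite lt_min r0.
rewrite lt_min => /andP[wr ws]; rewrite ff1 //.
rewrite (le_trans (cmod_triangle _ _)) // lerD2l cmodM.
by rewrite ler_pM ?cmod_ge0 ?f1M // ltW.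
Qed.

Lemma jetW n m f z : (m <= n)%N -> jet n f z -> jet m f z.
Proof.
elim: n m f => [|n IH] [|m] f //; first by move=> _; exact: jetW0.
by move=> mn [f1 [/(IH m) f1n fr]]; exists f1; split => //; exact: f1n.
Qed.

Lemma jet_cst n c z : jet n (fun=> c) z.
Proof.
elim: n c => [|n IH] c; first by exists (cmod c), 1.
exists (fun=> 0); split=> //; exists 1; split => // w _.
by rewrite mulr0 addr0.
Qed.

Lemma jet_id n z : jet n id z.
Proof.
case: n => [|n].
  exists (cmod z + 1), 1; split => // w wz.
  rewrite -[w in leLHS](subrK z) addrC (le_trans (cmod_triangle _ _)) //.
  by rewrite lerD2l ltW.
exists (fun=> 1); split; first exact: jet_cst.
by exists 1; split => // w _; rewrite mulr1 addrC subrK.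
Qed.

Lemma jetD n f g z : jet n f z -> jet n g z -> jet n (fun w => f w + g w) z.
Proof.
elim: n f g => [|n IH] f g.
  move=> [M [r [r0 fM]]] [N [s [s0 gN]]].
  exists (M + N), (Num.min r s); split=> [|w]; first by rewrite lt_min r0.
  rewrite lt_min => /andP[wr ws].
  by rewrite (le_trans (cmod_triangle _ _)) // lerD ?fM ?gN.
move=> [f1 [f1n [r [r0 ff1]]]] [g1 [g1n [s [s0 gg1]]]].
exists (fun w => f1 w + g1 w); split; first exact: IH.
exists (Num.min r s); split=> [|w]; first by rewrite lt_min r0.
by rewrite lt_min => /andP[wr ws]; rewrite ff1 // gg1 //; ring.
Qed.

Lemma jetM n f g z : jet n f z -> jet n g z -> jet n (fun w => f w * g w) z.
Proof.
elim: n f g => [|n IH] f g.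
  move=> [M [r [r0 fM]]] [N [s [s0 gN]]].
  exists (M * N), (Num.min r s); split=> [|w]; first by rewrite lt_min r0.
  rewrite lt_min => /andP[wr ws].
  by rewrite cmodM ler_pM ?cmod_ge0 ?fM ?gN.
move=> [f1 [f1n [r [r0 ff1]]]] gn1.
have gn : jet n g z by exact: jetW gn1.
case: gn1 => [g1 [g1n [s [s0 gg1]]]].
exists (fun w => f1 w * g w + f z * g1 w); split.
  by apply: jetD; apply: IH => //; exact: jet_cst.
exists (Num.min r s); split=> [|w]; first by rewrite lt_min r0.
by rewrite lt_min => /andP[wr ws]; rewrite ff1 // gg1 //; ring.
Qed.

Lemma jetN n f z : jet n f z -> jet n (fun w => - f w) z.
Proof.
move=> fn; have := jetM (jet_cst n (-1) z) fn; apply: jet_ext.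
by exists 1; split => // w _; rewrite mulN1r.
Qed.

Lemma jetB n f g z : jet n f z -> jet n g z -> jet n (fun w => f w - g w) z.
Proof. by move=> fn /jetN; exact: jetD. Qed.

Lemma jetX n m f z : jet n f z -> jet n (fun w => f w ^+ m) z.
Proof.
move=> fn; elim: m => [|m IH]; first exact: jet_cst.
have := jetM fn IH; apply: jet_ext.
by exists 1; split => // w _; rewrite exprS.
Qed.

Lemma jet_lip f z : jet 1 f z -> exists M r : R, [/\ 0 < M, 0 < r &
  forall w, cmod (w - z) < r -> cmod (f w - f z) <= M * cmod (w - z)].
Proof.
move=> [f1 [[M [r [r0 f1M]]] [s [s0 ff1]]]].
exists (`|M| + 1), (Num.min r s); split=> [||w]; rewrite ?lt_min ?r0 //.
move=> /andP[wr ws]; rewrite ff1 // addrC addKr cmodM mulrC.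
rewrite ler_wpM2r ?cmod_ge0 // (le_trans (f1M _ wr)) //.
by rewrite (le_trans (ler_norm _)) // lerDl.
Qed.

Lemma jet_cvg f z : jet 1 f z -> forall e, 0 < e -> exists r : R, 0 < r /\
  forall w, cmod (w - z) < r -> cmod (f w - f z) < e.
Proof.
move=> /jet_lip [M [r [M0 r0 fM]]] e e0.
exists (Num.min r (e / M)); split=> [|w]; first by rewrite lt_min r0 divr_gt0.
rewrite lt_min => /andP[wr we]; rewrite (le_lt_trans (fM _ wr)) //.
by rewrite mulrC -ltr_pdivlMr.
Qed.

(** Continuity bounds [1/f] near the centre, and the difference quotient of
    [1/f] is [- f1 / (f(z) f)], so each further order follows from the rule for
    products. *)
Lemma jetV n f z : jet n.+1 f z -> f z != 0 -> jet n (fun w => (f w)^-1) z.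
Proof.
move=> fn fz.
have [|r [r0 fr]] := jet_cvg (jetW (ltn0Sn n) fn) (e := cmod (f z) / 2).
  by rewrite divr_gt0 ?cmod_gt0.
have fge w : cmod (w - z) < r -> cmod (f z) / 2 <= cmod (f w).
  move=> /fr; have := cmod_triangle (f z - f w) (f w).
  by rewrite subrK (cmodB (f z)) => h1 h2; lra.
have fge0 w : cmod (w - z) < r -> f w != 0.
  move=> /fge h; rewrite -cmod_gt0 (lt_le_trans _ h) //.
  by rewrite divr_gt0 ?cmod_gt0.
have inv0 : jet 0 (fun w => (f w)^-1) z.
  exists (cmod (f z) / 2)^-1, r; split=> // w wr.
  rewrite cmodV lef_pV2 ?fge // posrE ?divr_gt0 ?cmod_gt0 //.
  exact: fge0.
elim: n fn => [_ //|n IH] fn.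
have inv := IH (jetW (leqnSn _) fn).
case: fn => [f1 [f1n [s [s0 ff1]]]].
exists (fun w => - (f z)^-1 * (f1 w * (f w)^-1)); split.
  apply: jetM; first exact: jet_cst.
  by apply: jetM (jetW (leqnSn n) f1n) _.
exists (Num.min r s); split=> [|w]; first by rewrite lt_min r0.
rewrite lt_min => /andP[wr ws].
have fw := fge0 _ wr.
have h : (w - z) * f1 w = f w - f z by rewrite [f w]ff1 //; ring.
have -> : (w - z) * (- (f z)^-1 * (f1 w * (f w)^-1)) =
  - (f z)^-1 * ((w - z) * f1 w) * (f w)^-1 by ring.
by rewrite h; field; rewrite fz fw.
Qed.

Lemma jet_conj n f z : jet n f z^*%C -> jet n (fun w => (f w^*%C)^*%C) z.
Proof.
have cj w : cmod (w^*%C - z^*%C) = cmod (w - z).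
  by rewrite -raddfB cmod_conj.
elim: n f => [|n IH] f.
  move=> [M [r [r0 fM]]]; exists M, r; split=> // w wr.
  by rewrite cmod_conj fM // cj.
move=> [f1 [/IH f1n [r [r0 ff1]]]]; exists (fun w => (f1 w^*%C)^*%C).
split=> //; exists r; split=> // w wr.
by rewrite ff1 ?cj // rmorphD rmorphM /= rmorphB /= !conjcK.
Qed.

Lemma jet_shift n f c z : jet n f (z + c) -> jet n (fun w => f (w + c)) z.
Proof.
have sh w : w + c - (z + c) = w - z by ring.
elim: n f => [|n IH] f.
  by move=> [M [r [r0 fM]]]; exists M, r; split=> // w wr; rewrite fM ?sh.
move=> [f1 [/IH f1n [r [r0 ff1]]]]; exists (fun w => f1 (w + c)).
by split=> //; exists r; split=> // w wr; rewrite ff1 ?sh.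
Qed.

(** At [z] the difference quotient takes the value of the nested quotient
    there, so that the singularity of [(f w - f z) / (w - z)] is removed. *)
Lemma jet_divdiff f (D : set R[i]) z0 n :
  jet n.+1 f z0 -> (forall z, D z -> jet n.+1 f z) ->
  exists g, [/\ forall z, z != z0 -> g z = (f z - f z0) / (z - z0),
    jet n g z0 & forall z, D z -> jet n g z].
Proof.
move=> [f1 [f1n [r [r0 ff1]]]] fD.
pose g z := if z == z0 then f1 z0 else (f z - f z0) / (z - z0).
have g0 : jet n g z0.
  apply: jet_ext f1n; exists r; split=> // w wr.
  rewrite /g; case: eqVneq => [->//|wz]; rewrite ff1 // addrC addKr.
  by rewrite mulrAC divff ?mul1r // subr_eq0.
exists g; split=> // [z /negbTE zz|z Dz]; first by rewrite /g zz.
have [->//|zz] := eqVneq z z0.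
have : jet n (fun w => (f w - f z0) * (w - z0)^-1) z.
  apply: jetM; first by apply: jetB; [exact: jetW (fD _ Dz)|exact: jet_cst].
  apply: jetV; last by rewrite subr_eq0.
  by apply: jetB; [exact: jet_id|exact: jet_cst].
apply: jet_ext; exists (cmod (z - z0)).
split; first by rewrite cmod_gt0 subr_eq0.
move=> w wz; rewrite /g; case: eqVneq wz => // ->.
by rewrite cmodB ltxx.
Qed.

End Jets.

(** * Expansions of analytic functions *)

Section PowerSeries.
Context {R : realType}.
Implicit Types (f : R[i] -> R[i]) (a : nat -> R[i]) (z w : R[i]).

Definition power_sum a f z0 (r : R) := forall z, cmod (z - z0) < r ->
  forall e, 0 < e -> exists N, forall n, (N <= n)%N ->
    cmod (f z - \sum_(k < n) a k * (z - z0) ^+ k) < e.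

Lemma cvg_cmod (u : nat -> R[i]) (l : R[i]) :
  (u : nat -> R[i]^o) @ \oo --> (l : R[i]^o) ->
  forall e, 0 < e -> exists N, forall n, (N <= n)%N -> cmod (l - u n) < e.
Proof.
move=> /cvgrPdist_lt ul e e0; have [] := ul e%:C; first by rewrite ltcR.
move=> N _ NP; exists N => n /NP /=.
by rewrite norm_cmod ltcR.
Qed.

Lemma analytic_power_sum (D : set R[i]) f z0 : analytic_on D f -> D z0 ->
  exists a r, 0 < r /\ power_sum a f z0 r.
Proof.
move=> fD /fD [a [r [r0 fa]]]; exists a, r; split=> // z /fa az e e0.
have [N NP] := cvg_cmod az e0; exists N => n /NP.
by rewrite /series /= big_mkord.
Qed.

Lemma power_sum_center a f z0 r : 0 < r -> power_sum a f z0 r -> f z0 = a 0%N.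
Proof.
move=> r0 /(_ z0); rewrite subrr cmod0 => /(_ r0) fa.
apply/eqP; rewrite -subr_eq0; apply: contraT => ne.
have [|N /(_ N.+1 (leqnSn _))] := fa (cmod (f z0 - a 0%N)).
  by rewrite cmod_gt0.
rewrite big_ord_recl expr0 mulr1 big1 => [|i _]; last first.
  by rewrite /= expr0n mulr0.
by rewrite addr0 ltxx.
Qed.

(** Convergence at a point [rho] away from the centre bounds [a k * rho ^+ k],
    and halving the radius turns the series into a geometric one. *)
Lemma power_sum_bounded a f z0 r : 0 < r -> power_sum a f z0 r -> jet 0 f z0.
Proof.
move=> r0 fa; pose rho := r / 2; have rho0 : 0 < rho by rewrite divr_gt0.
have zr : cmod (z0 + rho%:C - z0) = rho.
  by rewrite addrC addKr cmod_real gtr0_norm.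
have [||N NP] := fa (z0 + rho%:C) _ 1 => //.
  by rewrite zr /rho ltr_pdivrMr // mulr_natr mulr2n ltr_pwDl.
have hz : z0 + rho%:C - z0 = rho%:C by rewrite addrC addKr.
have tail n : (N <= n)%N -> cmod (a n) * rho ^+ n <= 2.
  move=> Nn; have := NP n Nn; have := NP n.+1 (leqW Nn).
  rewrite big_ord_recr /= hz; set S := \sum_(i < n) _ => h1 h2.
  have -> : cmod (a n) * rho ^+ n =
     cmod ((f (z0 + rho%:C) - S) - (f (z0 + rho%:C) - (S + a n * rho%:C ^+ n))).
    rewrite (_ : _ - _ = a n * rho%:C ^+ n); last by ring.
    by rewrite cmodM cmodX cmod_real gtr0_norm.
  by rewrite (le_trans (cmod_triangleB _ _)) //; lra.
pose M := 2 + \sum_(k < N) cmod (a k) * rho ^+ k.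
have t0 k : 0 <= cmod (a k) * rho ^+ k.
  by rewrite mulr_ge0 ?cmod_ge0 ?exprn_ge0 // ltW.
have aM n : cmod (a n) * rho ^+ n <= M.
  have [nN|Nn] := ltnP n N; last first.
    by rewrite (le_trans (tail _ Nn)) // lerDl sumr_ge0.
  rewrite /M (bigD1 (Ordinal nN)) //= addrCA lerDl addr_ge0 //.
  by rewrite sumr_ge0.
exists (2 * M + 1), (rho / 2); split=> [|w wr]; first by rewrite divr_gt0.
have [||K /(_ K (leqnn _)) KP] := fa w _ 1 => //.
  by rewrite (lt_trans wr) // /rho; lra.
suff S n : \sum_(k < n) cmod (a k * (w - z0) ^+ k) <= M * (2 - 2 * 2^-1 ^+ n).
  rewrite -[f w](subrK (\sum_(k < K) a k * (w - z0) ^+ k)) addrC.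
  rewrite (le_trans (cmod_triangle _ _)) // lerD //; last exact: ltW.
  have: cmod (\sum_(k < K) a k * (w - z0) ^+ k) <=
    \sum_(k < K) cmod (a k * (w - z0) ^+ k).
    elim/big_ind2: _ => [|x b y c xb yc|//]; first by rewrite cmod0.
    by rewrite (le_trans (cmod_triangle _ _)) // lerD.
  move=> /le_trans; apply; rewrite (le_trans (S K)) // mulrC ler_wpM2r //.
    by rewrite (le_trans (t0 0%N)).
  by rewrite lerBlDr lerDl mulr_ge0 // exprn_ge0.
elim: n => [|n IH]; first by rewrite big_ord0 expr0 mulr1 subrr mulr0.
rewrite big_ord_recr /=.
have : cmod (a n * (w - z0) ^+ n) <= M * 2^-1 ^+ n.
  rewrite cmodM cmodX.
  have h : cmod (w - z0) ^+ n <= rho ^+ n * 2^-1 ^+ n.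
    by rewrite -exprMn lerXn2r ?nnegrE ?cmod_ge0 ?ltW // divr_gt0.
  rewrite (le_trans (ler_wpM2l (cmod_ge0 _) h)) // mulrA ler_wpM2r // aM.
move: IH; rewrite exprS; set q := 2^-1 ^+ n; nra.
Qed.

(** Dropping the constant term and dividing by [z - z0] again gives a power
    series, of the same radius; iterating this yields jets of every order. *)
Lemma power_sum_shift a f z0 r : 0 < r -> power_sum a f z0 r ->
  power_sum (fun k => a k.+1)
    (fun w => if w == z0 then a 1%N else (f w - f z0) / (w - z0)) z0 r.
Proof.
move=> r0 fa z zr e e0; case: eqVneq => [->|zz].
  exists 1%N => -[//|n] _; rewrite subrr big_ord_recl expr0 mulr1 big1 => [|i _].
    by rewrite addr0 subrr cmod0.
  by rewrite /= expr0n mulr0.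
have z0n : z - z0 != 0 by rewrite subr_eq0.
have zc : 0 < cmod (z - z0) by rewrite cmod_gt0.
have [|N NP] := fa z zr (e * cmod (z - z0)); first by rewrite mulr_gt0.
exists N => n Nn; have := NP n.+1 (leqW Nn).
rewrite big_ord_recl expr0 mulr1 -(power_sum_center r0 fa).
rewrite -ltr_pdivrMr // -cmodV -cmodM; congr (cmod _ < e).
rewrite opprD addrA mulrBl; congr (_ - _).
rewrite mulr_suml; apply: eq_bigr => i _ /=.
by rewrite /bump /= add1n exprS; field.
Qed.

Lemma jet_power_sum a f z0 r n : 0 < r -> power_sum a f z0 r -> jet n f z0.
Proof.
elim: n a f => [|n IH] a f r0 fa; first exact: power_sum_bounded fa.
exists (fun w => if w == z0 then a 1%N else (f w - f z0) / (w - z0)); split.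
  exact: IH (power_sum_shift r0 fa).
exists r; split=> // w wr; case: eqVneq => [->|wz].
  by rewrite subrr mul0r addr0.
by rewrite mulrC divfK ?subr_eq0 // addrC subrK.
Qed.

Lemma analytic_jet (D : set R[i]) f z n : analytic_on D f -> D z -> jet n f z.
Proof.
move=> fD Dz; have [a [r [r0 fa]]] := analytic_power_sum fD Dz.
exact: jet_power_sum fa.
Qed.

End PowerSeries.

(** * Integration of complex functions *)

Section ComplexIntegral.
Context d {T : measurableType d} {R : realType}.
Context (mu : {measure set T -> \bar R}).
Implicit Types (D : set T) (h g : T -> R[i]) (c : R[i]).

Definition cintegrable D h :=
  mu.-integrable D (EFin \o (fun x => complex.Re (h x))) /\
  mu.-integrable D (EFin \o (fun x => complex.Im (h x))).

Definition cint D h : R[i] :=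
  (\int[mu]_(x in D) complex.Re (h x)) +i* (\int[mu]_(x in D) complex.Im (h x)).

Lemma eq_cint D h g : (forall x, D x -> h x = g x) -> cint D h = cint D g.
Proof.
by move=> hg; congr (_ +i* _); apply: eq_Rintegral => x /set_mem /hg ->.
Qed.

Lemma eq_cintegrable D h g : measurable D -> (forall x, D x -> h x = g x) ->
  cintegrable D h -> cintegrable D g.
Proof.
move=> mD hg [h1 h2]; split.
  by apply: (eq_integrable mD _ _ _ h1) => // x /set_mem /hg /= ->.
by apply: (eq_integrable mD _ _ _ h2) => // x /set_mem /hg /= ->.
Qed.

Lemma cintegrableD D h g : measurable D -> cintegrable D h -> cintegrable D g ->
  cintegrable D (fun x => h x + g x).
Proof.
move=> mD [h1 h2] [g1 g2]; split.
  apply: (eq_integrable mD _ _ _ (integrableD mD h1 g1)) => // x _ /=.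
  by rewrite cReD EFinD.
apply: (eq_integrable mD _ _ _ (integrableD mD h2 g2)) => // x _ /=.
by rewrite cImD EFinD.
Qed.

Lemma integrable_lincomb D (u v : T -> R) (a b : R) : measurable D ->
  mu.-integrable D (EFin \o u) -> mu.-integrable D (EFin \o v) ->
  mu.-integrable D (EFin \o (fun x => a * u x + b * v x)).
Proof.
move=> mD ui vi.
exact: (eq_integrable mD _ _ _
  (integrableD mD (integrableZl mD a ui) (integrableZl mD b vi))).
Qed.

Lemma Rintegral_lincomb D (u v : T -> R) (a b : R) : measurable D ->
  mu.-integrable D (EFin \o u) -> mu.-integrable D (EFin \o v) ->
  \int[mu]_(x in D) (a * u x + b * v x) =
  a * \int[mu]_(x in D) u x + b * \int[mu]_(x in D) v x.
Proof.
move=> mD ui vi; rewrite RintegralD //.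
- by rewrite !RintegralZl.
- by apply: (eq_integrable mD _ _ _ (integrableZl mD a ui)).
- by apply: (eq_integrable mD _ _ _ (integrableZl mD b vi)).
Qed.

Lemma cintegrableZ D c h : measurable D -> cintegrable D h ->
  cintegrable D (fun x => c * h x).
Proof.
move=> mD [h1 h2]; split.
  apply: (eq_integrable mD _ _ _
    (integrable_lincomb (complex.Re c) (- complex.Im c) mD h1 h2)) => // x _ /=.
  by rewrite cReM mulNr.
apply: (eq_integrable mD _ _ _
    (integrable_lincomb (complex.Im c) (complex.Re c) mD h1 h2)) => // x _ /=.
by rewrite cImM addrC.
Qed.

Lemma cintD D h g : measurable D -> cintegrable D h -> cintegrable D g ->
  cint D (fun x => h x + g x) = cint D h + cint D g.
Proof.
move=> mD [h1 h2] [g1 g2]; apply: complex_eq => /=.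
  by rewrite -RintegralD //; apply: eq_Rintegral => x _; rewrite cReD.
by rewrite -RintegralD //; apply: eq_Rintegral => x _; rewrite cImD.
Qed.

Lemma cintZ D c h : measurable D -> cintegrable D h ->
  cint D (fun x => c * h x) = c * cint D h.
Proof.
move=> mD [h1 h2]; apply: complex_eq; rewrite ?cReM ?cImM /=.
  rewrite -mulNr -Rintegral_lincomb //; apply: eq_Rintegral => x _.
  by rewrite cReM mulNr.
rewrite addrC -Rintegral_lincomb //; apply: eq_Rintegral => x _.
by rewrite cImM addrC.
Qed.

Lemma cintegrableB D h g : measurable D -> cintegrable D h -> cintegrable D g ->
  cintegrable D (fun x => h x - g x).
Proof.
move=> mD hi gi; apply: (eq_cintegrable (h := fun x => h x + -1 * g x)) => //.
  by move=> x _; rewrite mulN1r.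
by apply: cintegrableD => //; exact: cintegrableZ.
Qed.

Lemma cintB D h g : measurable D -> cintegrable D h -> cintegrable D g ->
  cint D (fun x => h x - g x) = cint D h - cint D g.
Proof.
move=> mD hi gi; rewrite -[- cint D g]mulN1r -cintZ // -cintD //.
  by apply: eq_cint => x _; rewrite mulN1r.
exact: cintegrableZ.
Qed.

Lemma cint_cst D c : measurable D -> cint D (fun=> c) = c * (fine (mu D))%:C.
Proof.
move=> mD; apply: complex_eq; rewrite ?cReM ?cImM /= Rintegral_cst //.
  by rewrite mulr0 subr0.
by rewrite mulr0 add0r.
Qed.

(** The factor 2 comes from treating real and imaginary parts separately.  The
    bound [k] may take the value [+oo]; this is used with a weight that is infinite
    at some points. *)
Lemma cmod_cint_le D h (k : T -> \bar R) : measurable D -> cintegrable D h ->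
  measurable_fun D k -> (forall x, D x -> (cmod (h x))%:E <= k x)%E ->
  ((cmod (cint D h))%:E <= 2%:E * \int[mu]_(x in D) k x)%E.
Proof.
move=> mD [h1 h2] mk hk.
have part (u : T -> R) : mu.-integrable D (EFin \o u) ->
    (forall x, D x -> `|u x| <= cmod (h x)) ->
    (`|\int[mu]_(x in D) u x|%:E <= \int[mu]_(x in D) k x)%E.
  move=> iu uh; rewrite EFin_normr_Rintegral //.
  rewrite (le_trans (le_abse_integral _ _ _)) //.
    by case/integrableP : iu.
  apply: ge0_le_integral => //.
  - by case/integrableP : iu => mu_ _; exact: measurableT_comp.
  - move=> x Dx; rewrite (le_trans _ (hk _ Dx)) //= lee_fin.
    exact: uh.
rewrite (_ : 2 = 1 + 1) // EFinD ge0_muleDl ?lee_fin // mul1e.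
apply: (@le_trans _ _ (`|complex.Re (cint D h)|%:E + `|complex.Im (cint D h)|%:E)%E).
  by rewrite -EFinD lee_fin cmod_le_ReIm.
apply: leeD; apply: part => // x Dx; [exact: cmodRe|exact: cmodIm].
Qed.

End ComplexIntegral.

Section Segments.
Context {R : realType}.
Notation leb := (@lebesgue_measure R).
Implicit Types (E F : R[i] -> R[i]) (a b x y : R).

Lemma lebesgue_seg a b : a <= b -> leb `[a, b] = (b - a)%:E.
Proof.
rewrite le_eqVlt => /predU1P[->|ab].
  by rewrite subrr set_itv1 lebesgue_measure_set1.
by rewrite lebesgue_measure_itv /= lte_fin ab.
Qed.

Lemma continuous_path (part : R[i] -> R) (p : R -> R[i]) E t :
  (forall z w, `|part z - part w| <= cmod (z - w)) ->
  (forall s t, cmod (p s - p t) = `|s - t|) -> jet 1 E (p t) ->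
  {for t, continuous (fun t => part (E (p t)))}.
Proof.
move=> partl piso Ej; apply/cvgrPdist_lt => e e0.
have [r [r0 rE]] := jet_cvg Ej e0.
apply/nbhs_ballP; exists r => //= s st.
by rewrite (le_lt_trans (partl _ _)) // cmodB rE // piso distrC.
Qed.

Lemma Re_lip (z w : R[i]) : `|complex.Re z - complex.Re w| <= cmod (z - w).
Proof. by rewrite -cReN -cReD cmodRe. Qed.

Lemma Im_lip (z w : R[i]) : `|complex.Im z - complex.Im w| <= cmod (z - w).
Proof. by rewrite -cImN -cImD cmodIm. Qed.

Lemma cintegrable_path (p : R -> R[i]) E a b :
  (forall s t, cmod (p s - p t) = `|s - t|) ->
  (forall t, a <= t <= b -> jet 1 E (p t)) ->
  cintegrable leb `[a, b] (fun t => E (p t)).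
Proof.
move=> piso Ej.
split; apply: continuous_compact_integrable; try exact: segment_compact;
  apply: continuous_in_subspaceT => t /set_mem /=; rewrite in_itv /= => tab.
  by apply: continuous_path => //; [exact: Re_lip|exact: Ej].
by apply: continuous_path => //; [exact: Im_lip|exact: Ej].
Qed.

Lemma Rintegral_seg_cst (K a b : R) : a <= b ->
  \int[leb]_(t in `[a, b]) K = K * (b - a).
Proof.
move=> ab; rewrite Rintegral_cst //.
by rewrite -[b - a]/(fine (b - a)%:E) -(lebesgue_seg ab).
Qed.

Lemma integrable_seg_cst (K a b : R) :
  leb.-integrable `[a, b] (EFin \o (fun=> K)).
Proof.
apply: continuous_compact_integrable; first exact: segment_compact.
by apply: continuous_subspaceT => x; exact: cvg_cst.
Qed.

Lemma Rintegral_seg_le (u : R -> R) a b K : a <= b ->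
  leb.-integrable `[a, b] (EFin \o u) -> (forall t, a <= t <= b -> u t <= K) ->
  \int[leb]_(t in `[a, b]) u t <= K * (b - a).
Proof.
move=> ab ui uK; rewrite -Rintegral_seg_cst //; apply: le_Rintegral => //.
exact: integrable_seg_cst.
Qed.

Lemma Rintegral_seg_ge (u : R -> R) a b K : a <= b ->
  leb.-integrable `[a, b] (EFin \o u) -> (forall t, a <= t <= b -> K <= u t) ->
  K * (b - a) <= \int[leb]_(t in `[a, b]) u t.
Proof.
move=> ab ui uK; rewrite -Rintegral_seg_cst //; apply: le_Rintegral => //.
exact: integrable_seg_cst.
Qed.

Lemma cmod_cint_seg_le (h : R -> R[i]) a b K : a <= b ->
  cintegrable leb `[a, b] h -> (forall t, a <= t <= b -> cmod (h t) <= K) ->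
  cmod (cint leb `[a, b] h) <= 2 * (K * (b - a)).
Proof.
move=> ab hi hK.
have hle t : [set` `[a, b]] t -> ((cmod (h t))%:E <= K%:E)%E.
  by rewrite /= in_itv /= => /hK; rewrite lee_fin.
have /(_ (measurable_itv _)) := cmod_cint_le _ hi (measurable_cst K%:E) hle.
by rewrite integral_cst //= lebesgue_seg // -!EFinM lee_fin.
Qed.

Lemma cint_seg_cst (c : R[i]) a b : a <= b ->
  cint leb `[a, b] (fun=> c) = c * (b - a)%:C.
Proof.
by move=> ab; rewrite cint_cst // -[b - a]/(fine (b - a)%:E) -(lebesgue_seg ab).
Qed.

Lemma cint_seg_split (h : R -> R[i]) a m b : a <= m -> m <= b ->
  cintegrable leb `[a, b] h ->
  cint leb `[a, b] h = cint leb `[a, m] h + cint leb `[m, b] h.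
Proof.
move=> am mb [h1 h2].
have part (u : R -> R) : leb.-integrable `[a, b] (EFin \o u) ->
    \int[leb]_(t in `[a, b]) u t =
    \int[leb]_(t in `[a, m]) u t + \int[leb]_(t in `[m, b]) u t.
  move=> iu; rewrite -(@Rintegral_itv_obnd_cbnd _ m).
    rewrite -(@Rintegral_itvB _ u (BLeft a) (BRight b) m) ?bnd_simp //.
    by rewrite addrC subrK.
  by apply: integrableS iu => //; exact: subset_itv.
by apply: complex_eq; exact: part.
Qed.

End Segments.

(** * Goursat's theorem for rectangles *)

Section Goursat.
Context {R : realType}.
Notation leb := (@lebesgue_measure R).
Implicit Types (E F : R[i] -> R[i]) (x y : R).

Definition horiz_int E y a b : R[i] := cint leb `[a, b] (fun t => E (t +i* y)).

Definition vert_int E x a b : R[i] := cint leb `[a, b] (fun t => E (x +i* t)).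

(** The contour integral of [E dz] along the boundary of a rectangle,
    counterclockwise. *)
Definition rect_int E x0 x1 y0 y1 : R[i] :=
  horiz_int E y0 x0 x1 + 'i%C * vert_int E x1 y0 y1
  - horiz_int E y1 x0 x1 - 'i%C * vert_int E x0 y0 y1.

Definition jet_rect n E x0 x1 y0 y1 :=
  forall x y, x0 <= x <= x1 -> y0 <= y <= y1 -> jet n E (x +i* y).

Lemma jet_rectS n E x0 x1 y0 y1 x0' x1' y0' y1' :
  x0 <= x0' -> x1' <= x1 -> y0 <= y0' -> y1' <= y1 ->
  jet_rect n E x0 x1 y0 y1 -> jet_rect n E x0' x1' y0' y1'.
Proof.
move=> h1 h2 h3 h4 hj x y /andP[h5 h6] /andP[h7 h8].
by apply: hj; apply/andP; split; lra.
Qed.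

Lemma cintegrable_h E y a b : (forall x, a <= x <= b -> jet 1 E (x +i* y)) ->
  cintegrable leb `[a, b] (fun t => E (t +i* y)).
Proof.
move=> hj; apply: (cintegrable_path (p := fun t => t +i* y)) => // s t.
by rewrite -cmod_real; congr cmod; apply: complex_eq => //=; rewrite subrr.
Qed.

Lemma cintegrable_v E x a b : (forall y, a <= y <= b -> jet 1 E (x +i* y)) ->
  cintegrable leb `[a, b] (fun t => E (x +i* t)).
Proof.
move=> hj; apply: (cintegrable_path (p := fun t => x +i* t)) => // s t.
rewrite -[RHS]mul1r -cmodi -cmod_real -cmodM; congr cmod.
by apply: complex_eq; rewrite ?cReM ?cImM /=; ring.
Qed.

Lemma cintegrable_sides E x0 x1 y0 y1 : x0 <= x1 -> y0 <= y1 ->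
  jet_rect 1 E x0 x1 y0 y1 ->
  [/\ cintegrable leb `[x0, x1] (fun t => E (t +i* y0)),
      cintegrable leb `[x0, x1] (fun t => E (t +i* y1)),
      cintegrable leb `[y0, y1] (fun t => E (x0 +i* t)) &
      cintegrable leb `[y0, y1] (fun t => E (x1 +i* t))].
Proof.
move=> hx hy hj; split.
- by apply: cintegrable_h => x hx'; apply: hj => //; rewrite lexx.
- by apply: cintegrable_h => x hx'; apply: hj => //; rewrite lexx andbT.
- by apply: cintegrable_v => y hy'; apply: hj => //; rewrite lexx.
- by apply: cintegrable_v => y hy'; apply: hj => //; rewrite lexx andbT.
Qed.

Lemma rect_intD E F x0 x1 y0 y1 : x0 <= x1 -> y0 <= y1 ->
  jet_rect 1 E x0 x1 y0 y1 -> jet_rect 1 F x0 x1 y0 y1 ->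
  rect_int (fun w => E w + F w) x0 x1 y0 y1 =
  rect_int E x0 x1 y0 y1 + rect_int F x0 x1 y0 y1.
Proof.
move=> hx hy /(cintegrable_sides hx hy) [e1 e2 e3 e4].
move=> /(cintegrable_sides hx hy) [f1 f2 f3 f4].
by rewrite /rect_int /horiz_int /vert_int !cintD //; ring.
Qed.

Lemma rect_int_cmod_le E x0 x1 y0 y1 K : x0 <= x1 -> y0 <= y1 ->
  jet_rect 1 E x0 x1 y0 y1 ->
  (forall x y, x0 <= x <= x1 -> y0 <= y <= y1 -> cmod (E (x +i* y)) <= K) ->
  cmod (rect_int E x0 x1 y0 y1) <= 4 * K * ((x1 - x0) + (y1 - y0)).
Proof.
move=> hx hy /(cintegrable_sides hx hy) [e1 e2 e3 e4] EK.
rewrite /rect_int; set a := horiz_int _ _ _ _; set b := horiz_int _ _ _ _.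
set c := vert_int _ _ _ _; set e := vert_int _ _ _ _.
have ha : cmod a <= 2 * (K * (x1 - x0)).
  by apply: cmod_cint_seg_le => // t ht; apply: EK; rewrite ?lexx.
have hb : cmod b <= 2 * (K * (x1 - x0)).
  by apply: cmod_cint_seg_le => // t ht; apply: EK; rewrite ?lexx ?andbT.
have hc : cmod c <= 2 * (K * (y1 - y0)).
  by apply: cmod_cint_seg_le => // t ht; apply: EK; rewrite ?lexx ?andbT.
have he : cmod e <= 2 * (K * (y1 - y0)).
  by apply: cmod_cint_seg_le => // t ht; apply: EK; rewrite ?lexx.
have h1 := cmod_triangleB (a + 'i%C * c - b) ('i%C * e).
have h2 := cmod_triangleB (a + 'i%C * c) b.
have h3 := cmod_triangle a ('i%C * c).
by move: h1 h3; rewrite !cmodM !cmodi !mul1r => h1 h3; nra.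
Qed.

Lemma rect_int_affine c e x0 x1 y0 y1 : x0 <= x1 -> y0 <= y1 ->
  rect_int (fun w => c + e * w) x0 x1 y0 y1 = 0.
Proof.
move=> hx hy.
have hj : jet_rect 1 (fun w => c + e * w) x0 x1 y0 y1.
  move=> x y _ _; apply: jetD; first exact: jet_cst.
  by apply: jetM; [exact: jet_cst|exact: jet_id].
have [e1 e2 e3 e4] := cintegrable_sides hx hy hj.
rewrite /rect_int /horiz_int /vert_int.
have -> (a b a' b' : R[i]) : a + 'i%C * b - a' - 'i%C * b' = a - a' + 'i%C * (b - b').
  by ring.
rewrite -!cintB //.
rewrite (@eq_cint _ _ _ _ _ _ (fun=> e * ('i%C * (y0 - y1)%:C))); last first.
  move=> t _; rewrite (complexE (t +i* y0)) (complexE (t +i* y1)) /= rmorphB /=.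
  by ring.
rewrite [X in _ + 'i%C * X](@eq_cint _ _ _ _ _ _ (fun=> e * (x1 - x0)%:C)); last first.
  move=> t _; rewrite (complexE (x0 +i* t)) (complexE (x1 +i* t)) /= rmorphB /=.
  by ring.
rewrite !cint_seg_cst // !rmorphB /=; ring.
Qed.

Lemma rect_int_splitx E x0 m x1 y0 y1 : x0 <= m -> m <= x1 -> y0 <= y1 ->
  jet_rect 1 E x0 x1 y0 y1 ->
  rect_int E x0 x1 y0 y1 = rect_int E x0 m y0 y1 + rect_int E m x1 y0 y1.
Proof.
move=> h1 h2 hy hj.
have [e1 e2 e3 e4] := cintegrable_sides (le_trans h1 h2) hy hj.
rewrite /rect_int /horiz_int !(cint_seg_split h1 h2) //; ring.
Qed.

Lemma rect_int_splity E x0 x1 y0 m y1 : x0 <= x1 -> y0 <= m -> m <= y1 ->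
  jet_rect 1 E x0 x1 y0 y1 ->
  rect_int E x0 x1 y0 y1 = rect_int E x0 x1 y0 m + rect_int E x0 x1 m y1.
Proof.
move=> hx h1 h2 hj.
have [e1 e2 e3 e4] := cintegrable_sides hx (le_trans h1 h2) hj.
rewrite /rect_int /vert_int !(cint_seg_split h1 h2) //; ring.
Qed.

Lemma quarter_sum (a b c e : R[i]) (k : R) :
  4 * k <= cmod (a + b + (c + e)) ->
  [\/ k <= cmod a, k <= cmod b, k <= cmod c | k <= cmod e].
Proof.
move=> h; have h1 := cmod_triangle (a + b) (c + e).
have h2 := cmod_triangle a b; have h3 := cmod_triangle c e.
have [ha|ha] := leP k (cmod a); first by constructor 1.
have [hb|hb] := leP k (cmod b); first by constructor 2.
have [hc|hc] := leP k (cmod c); first by constructor 3.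
by constructor 4; lra.
Qed.

(** The inner sides cancel, so the integrals over the four quarters of a rectangle
    add up to the integral over the rectangle. *)
Lemma rect_int_quarter E x y a b k : 0 <= a -> 0 <= b ->
  jet_rect 1 E x (x + 2 * a) y (y + 2 * b) ->
  4 * k <= cmod (rect_int E x (x + 2 * a) y (y + 2 * b)) ->
  exists x' y', [/\ x <= x', x' + a <= x + 2 * a, y <= y', y' + b <= y + 2 * b &
    k <= cmod (rect_int E x' (x' + a) y' (y' + b))].
Proof.
move=> a0 b0 hj.
have ax : x <= x + a by rewrite lerDl.
have by_ : y <= y + b by rewrite lerDl.
have ax2 : x + a <= x + 2 * a by lra.
have by2 : y + b <= y + 2 * b by lra.
have axx : x + a + a = x + 2 * a by lra.
have byy : y + b + b = y + 2 * b by lra.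
have hj1 : jet_rect 1 E x (x + a) y (y + 2 * b).
  by apply: jet_rectS hj => //; lra.
have hj2 : jet_rect 1 E (x + a) (x + 2 * a) y (y + 2 * b).
  by apply: jet_rectS hj => //; lra.
rewrite (rect_int_splitx ax ax2) //; last by lra.
rewrite (rect_int_splity ax by_ by2) // (rect_int_splity ax2 by_ by2) //.
case/quarter_sum => h.
- by exists x, y; split=> //; lra.
- by exists x, (y + b); rewrite byy; split=> //; lra.
- by exists (x + a), y; rewrite axx; split=> //; lra.
- by exists (x + a), (y + b); rewrite axx byy; split=> //; lra.
Qed.

Lemma nested_limit (u : nat -> R) (l : nat -> R) : (forall n, 0 <= l n) ->
  (forall n, u n <= u n.+1) -> (forall n, u n.+1 + l n.+1 <= u n + l n) ->
  exists X, forall n, u n <= X <= u n + l n.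
Proof.
move=> l0 uS lS.
have um m n : (m <= n)%N -> u m <= u n.
  move=> /subnK <-; elim: (n - m)%N => [|k IH]; first by rewrite add0n.
  by rewrite addSn (le_trans IH).
have lm m n : (m <= n)%N -> u n + l n <= u m + l m.
  move=> /subnK <-; elim: (n - m)%N => [|k IH]; first by rewrite add0n.
  by rewrite addSn (le_trans _ IH).
have ub m n : u m <= u n + l n.
  have h1 := um _ _ (leq_maxl m n); have h2 := lm _ _ (leq_maxr m n).
  by have := l0 (maxn m n); lra.
exists (sup (range u)) => n; apply/andP; split.
  by apply: ub_le_sup; [exists (u 0%N + l 0%N) => _ [m _ <-]|exists n].
by apply: ge_sup; [exists (u 0%N), 0%N|move=> _ [m _ <-]].
Qed.

(** Goursat's theorem.  Repeated quartering yields rectangles shrinking to a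
    point at which [E] is affine up to a quadratic error.  Affine functions
    integrate to zero, so the n-th integral is O(8^-n); it is also at least
    4^-n times the initial one. *)
Lemma goursat E x0 x1 y0 y1 : x0 <= x1 -> y0 <= y1 ->
  jet_rect 2 E x0 x1 y0 y1 -> rect_int E x0 x1 y0 y1 = 0.
Proof.
move=> hx hy hj.
have hj1 : jet_rect 1 E x0 x1 y0 y1 by move=> x y ? ?; apply: jetW (hj _ _ _ _).
apply/eqP; rewrite -[_ == 0]negbK -cmod_gt0; apply/negP.
set c := cmod _ => c0.
pose q n : R := 2^-1 ^+ n.
have q0 n : 0 <= q n by rewrite exprn_ge0.
have qS n : q n = 2 * q n.+1 by rewrite /q exprS mulrA divff ?mul1r.
pose W := x1 - x0; pose H := y1 - y0.
have W0 : 0 <= W by rewrite subr_ge0.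
have H0 : 0 <= H by rewrite subr_ge0.
pose inv n (p : R * R) := [/\ x0 <= p.1, p.1 + W * q n <= x1,
  y0 <= p.2, p.2 + H * q n <= y1 &
  c * q n * q n <= cmod (rect_int E p.1 (p.1 + W * q n) p.2 (p.2 + H * q n))].
have step (s : nat * (R * R)) : exists p', inv s.1 s.2 -> inv s.1.+1 p' /\
    [/\ s.2.1 <= p'.1, p'.1 + W * q s.1.+1 <= s.2.1 + W * q s.1,
        s.2.2 <= p'.2 & p'.2 + H * q s.1.+1 <= s.2.2 + H * q s.1].
  case: s => n [x y] /=.
  have [[/= i1 i2 i3 i4 i5]|ni] := pselect (inv n (x, y)); last by exists (0, 0).
  have Wq : W * q n = 2 * (W * q n.+1) by rewrite qS; ring.
  have Hq : H * q n = 2 * (H * q n.+1) by rewrite qS; ring.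
  have cq : c * q n * q n = 4 * (c * q n.+1 * q n.+1) by rewrite qS; ring.
  have hjn : jet_rect 1 E x (x + W * q n) y (y + H * q n).
    exact: jet_rectS hj1.
  move: i5 hjn; rewrite cq Wq Hq => i5 hjn.
  have [||x' [y' [k1 k2 k3 k4 k5]]] := rect_int_quarter _ _ hjn i5.
  - by rewrite mulr_ge0.
  - by rewrite mulr_ge0.
  exists (x', y') => _; split; last by split.
  by split=> //=; lra.
have [F FP] := choice step.
pose fix u n : R * R := if n is m.+1 then F (m, u m) else (x0, y0).
have uinv n : inv n (u n).
  elim: n => [|n IH]; last by have [] := FP (n, u n) IH.
  rewrite /inv /q expr0 !mulr1 /W /H ![_ + (_ - _)]addrC !subrK.
  by split.
have un n := (FP (n, u n) (uinv n)).2.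
have [|n|n|X XP] := @nested_limit (fun n => (u n).1) (fun n => W * q n).
- by move=> n; rewrite mulr_ge0.
- by have [] := un n.
- by have [] := un n.
have [|n|n|Y YP] := @nested_limit (fun n => (u n).2) (fun n => H * q n).
- by move=> n; rewrite mulr_ge0.
- by have [] := un n.
- by have [] := un n.
have [E1 [[E2 [[M [r [r0 E2M]]] [r1 [r10 E1E]]]] [r2 [r20 EE]]]] :
    jet 2 E (X +i* Y).
  have := XP 0%N; have := YP 0%N; rewrite /= /q expr0 !mulr1 /W /H.
  move=> /andP[? ?] /andP[? ?].
  by apply: hj; apply/andP; split; lra.
set z := X +i* Y in E2M E1E EE.
pose rho := Num.min r (Num.min r1 r2).
have rho0 : 0 < rho by rewrite !lt_min r0 r10.
pose L := W + H + 1.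
have L0 : 0 < L by rewrite /L; lra.
have M0 : 0 <= M.
  by rewrite (le_trans (cmod_ge0 (E2 z))) // E2M // subrr cmod0.
pose rem w := (w - z) ^+ 2 * E2 w.
have Erem w : cmod (w - z) < rho ->
    E w = (E z - E1 z * z) + E1 z * w + rem w.
  rewrite !lt_min => /and3P[w1 w2 w3].
  by rewrite EE // E1E // /rem; ring.
(* For n large the n-th rectangle lies in the disk where the expansion holds,
   and this bounds its integral by a multiple of q n ^ 3. *)
have small n : L * q n < rho -> c <= 4 * M * L ^+ 3 * q n.
  move=> qrho; have [i1 i2 i3 i4 i5] := uinv n.
  move: (XP n) (YP n); set x := (u n).1; set y := (u n).2.
  move=> /andP[X1 X2] /andP[Y1 Y2].
  have qn0 : 0 < q n by rewrite exprn_gt0.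
  have dist s t : x <= s <= x + W * q n -> y <= t <= y + H * q n ->
      cmod (s +i* t - z) <= L * q n.
    move=> /andP[s1 s2] /andP[t1 t2].
    rewrite (le_trans (cmod_le_ReIm _)) //= /L.
    have h1 : `|s - X| <= W * q n by rewrite ler_norml; apply/andP; split; lra.
    have h2 : `|t - Y| <= H * q n by rewrite ler_norml; apply/andP; split; lra.
    by nra.
  have Wq0 : x <= x + W * q n by rewrite lerDl mulr_ge0.
  have Hq0 : y <= y + H * q n by rewrite lerDl mulr_ge0.
  have jE : jet_rect 1 E x (x + W * q n) y (y + H * q n) by exact: jet_rectS hj1.
  pose A w := (E z - E1 z * z) + E1 z * w.
  have jA : jet_rect 1 A x (x + W * q n) y (y + H * q n).
    move=> s t _ _; apply: jetD; first exact: jet_cst.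
    by apply: jetM; [exact: jet_cst|exact: jet_id].
  pose B w := E w - A w.
  have jB : jet_rect 1 B x (x + W * q n) y (y + H * q n).
    by move=> s t hs ht; apply: jetB; [exact: jE|exact: jA].
  have EAB : rect_int E x (x + W * q n) y (y + H * q n) =
             rect_int B x (x + W * q n) y (y + H * q n).
    have -> : E = (fun w => B w + A w) by apply/funext => w; rewrite /B subrK.
    by rewrite rect_intD // rect_int_affine // addr0.
  have BK s t : x <= s <= x + W * q n -> y <= t <= y + H * q n ->
      cmod (B (s +i* t)) <= (L * q n) ^+ 2 * M.
    move=> hs ht; have d := dist s t hs ht.
    have d' : cmod (s +i* t - z) < rho by exact: le_lt_trans qrho.
    rewrite /B Erem // /A [X in cmod X](_ : _ = rem (s +i* t)); last by ring.
    rewrite /rem cmodM cmodX ler_pM ?exprn_ge0 ?cmod_ge0 //.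
      by rewrite lerXn2r ?nnegrE ?cmod_ge0 // (le_trans (cmod_ge0 _) d).
    by apply: E2M; move: d'; rewrite lt_min => /andP[].
  have := rect_int_cmod_le Wq0 Hq0 jB BK; rewrite -EAB => hle.
  have := le_trans i5 hle.
  rewrite ![_ + _ - _]addrC !addKr -mulrDl => h3.
  have h4 : 4 * ((L * q n) ^+ 2 * M) * ((W + H) * q n) <=
      4 * ((L * q n) ^+ 2 * M) * (L * q n).
    have WHL : W + H <= L by rewrite /L lerDl.
    apply: ler_wpM2l; last exact: ler_wpM2r.
    by rewrite mulr_ge0 // mulr_ge0 // exprn_ge0 // mulr_ge0 // ltW.
  have h5 := le_trans h3 h4.
  have qq : 0 < q n * q n by rewrite mulr_gt0.
  rewrite -(ler_pM2r qq) mulrA (le_trans h5) //.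
  by rewrite le_eqVlt; apply/orP; left; apply/eqP; ring.
have qcvg e : 0 < e -> exists n, q n < e.
  move=> e0; have [n _ np] := near_infty_natSinv_expn_lt (PosNum e0).
  by exists n; have := np n (leqnn n); rewrite /q exprVn div1r.
pose K := 4 * M * L ^+ 3 + 1.
have K0 : 0 < K.
  rewrite /K ltr_wpDl // !mulr_ge0 ?exprn_ge0 // ltW //.
have [|n qn] := qcvg (Num.min (rho / L) (c / K)).
  by rewrite lt_min !divr_gt0.
move: qn; rewrite lt_min !ltr_pdivlMr // => /andP[q1 q2].
have := small n; rewrite mulrC => /(_ q1).
have : 0 <= q n by [].
move: q2; rewrite /K => q2 q3; nra.
Qed.

End Goursat.

(** * A maximum principle *)

Section MaximumPrinciple.
Context {R : realType}.
Implicit Types (v : R[i] -> R) (z w : R[i]) (x y : R).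

Definition cont_at v z := forall e, 0 < e -> exists r : R, 0 < r /\
  forall w, cmod (w - z) < r -> `|v w - v z| < e.

Lemma cont_atIm (f : R[i] -> R[i]) z : jet 1 f z ->
  cont_at (fun w => complex.Im (f w)) z.
Proof.
move=> /jet_cvg fz e /fz [r [r0 rP]]; exists r; split=> // w /rP.
by rewrite -cImN -cImD; apply: le_lt_trans; exact: cmodIm.
Qed.

Lemma cont_at_cmod (f : R[i] -> R[i]) z : jet 1 f z ->
  cont_at (fun w => cmod (f w)) z.
Proof.
move=> /jet_cvg fz e /fz [r [r0 rP]]; exists r; split=> // w /rP.
apply: le_lt_trans; rewrite ler_norml; apply/andP; split.
  by have := cmod_triangle (f z - f w) (f w); rewrite subrK cmodB; lra.
by have := cmod_triangle (f w - f z) (f z); rewrite subrK; lra.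
Qed.

Lemma cont_atD v1 v2 z : cont_at v1 z -> cont_at v2 z ->
  cont_at (fun w => v1 w + v2 w) z.
Proof.
move=> c1 c2 e e0.
have [|r1 [r10 P1]] := c1 (e / 2); first by rewrite divr_gt0.
have [|r2 [r20 P2]] := c2 (e / 2); first by rewrite divr_gt0.
exists (Num.min r1 r2); split; first by rewrite lt_min r10.
move=> w; rewrite lt_min => /andP[/P1 h1 /P2 h2].
have -> : v1 w + v2 w - (v1 z + v2 z) = (v1 w - v1 z) + (v2 w - v2 z) by ring.
by rewrite (le_lt_trans (ler_normD _ _)) //; lra.
Qed.

Lemma cont_at_Resqr (k a : R) z :
  cont_at (fun w => k * (complex.Re w - a) ^+ 2) z.
Proof.
move=> e e0; pose A := 2 * `|complex.Re z - a| + 1.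
have A0 : 0 < A by rewrite /A; have := normr_ge0 (complex.Re z - a); lra.
exists (Num.min 1 (e / ((`|k| + 1) * A))).
have k0 : 0 < `|k| + 1 by have := normr_ge0 k; lra.
split; first by rewrite lt_min ltr01 divr_gt0 // mulr_gt0.
move=> w; rewrite lt_min => /andP[h1 h2].
have h := cmodRe (w - z); rewrite cReD cReN in h.
set s := complex.Re w in h *; set t := complex.Re z in h A A0 h2 *.
have -> : k * (s - a) ^+ 2 - k * (t - a) ^+ 2 =
  k * ((s - t) * ((s - t) + 2 * (t - a))) by ring.
have h3 : `|s - t + 2 * (t - a)| <= A.
  rewrite (le_trans (ler_normD _ _)) // normrM (gtr0_norm (_ : 0 < 2)) // /A.
  by rewrite addrC lerD2l (le_trans h) // ltW.
rewrite !normrM; move: h2; rewrite ltr_pdivlMr ?mulr_gt0 // => h2.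
apply: le_lt_trans h2.
have h4 : `|s - t| * `|s - t + 2 * (t - a)| <= cmod (w - z) * A.
  exact: ler_pM.
by rewrite mulrCA ler_pM ?mulr_ge0 // ler_pM //; lra.
Qed.

Definition in_rect x0 x1 y0 y1 : set R[i] :=
  [set z | x0 <= complex.Re z <= x1 /\ y0 <= complex.Im z <= y1].

Lemma rect_max v x0 x1 y0 y1 : x0 <= x1 -> y0 <= y1 ->
  (forall z, in_rect x0 x1 y0 y1 z -> cont_at v z) ->
  exists2 z, in_rect x0 x1 y0 y1 z &
    forall w, in_rect x0 x1 y0 y1 w -> v w <= v z.
Proof.
move=> hx hy vc.
pose A : set (R * R) := [set` `[x0, x1]] `*` [set` `[y0, y1]].
have A0 : A !=set0 by exists (x0, y0); split; rewrite /= in_itv /= lexx.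
have cA : compact A by apply: compact_setX; exact: segment_compact.
have [|[a b] /set_mem[/= ha hb] abP] :=
    @compact_EVT_max _ R (fun p => v (p.1 +i* p.2)) A A0 cA.
  apply: continuous_in_subspaceT => -[a b] /set_mem [/=].
  rewrite !in_itv /= => ha hb.
  apply/cvgrPdist_lt => e e0.
  have [|r [r0 rP]] := vc (a +i* b) _ e e0; first by split.
  have r20 : 0 < r / 2 by rewrite divr_gt0.
  exists (ball a (r / 2), ball b (r / 2)).
    by split; exact: nbhsx_ballx.
  move=> [c d] [/= ac bd]; rewrite distrC; apply: rP.
  rewrite (le_lt_trans (cmod_le_ReIm _)) //=.
  move: ac bd; rewrite /ball /= => ac bd.
  by rewrite (distrC c) (distrC d) [ltRHS]splitr ltrD.
exists (a +i* b); first by split; move: ha hb; rewrite !in_itv.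
move=> [c d] [/= hc hd]; apply: (abP (c, d)).
by rewrite inE; split; rewrite /= in_itv.
Qed.

(** In the sum of the values at [z + t], [z - t], [z + i t], [z - i t] the
    Taylor terms of orders 1 and 2 cancel, so that [Im G] satisfies the mean
    value property up to O(t^3).  Adding a small multiple of the subharmonic
    function [(x - x0)^2] gains a multiple of t^2, and this excludes an interior
    maximum. *)
Lemma max_principle (G : R[i] -> R[i]) x0 x1 y0 y1 K : x0 <= x1 -> y0 <= y1 ->
  (forall z, in_rect x0 x1 y0 y1 z -> jet 3 G z) ->
  (forall z, in_rect x0 x1 y0 y1 z ->
     [\/ complex.Re z = x0, complex.Re z = x1,
         complex.Im z = y0 | complex.Im z = y1] -> complex.Im (G z) <= K) ->
  forall z, in_rect x0 x1 y0 y1 z -> complex.Im (G z) <= K.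
Proof.
move=> hx hy jG GK w1 w1r; apply/ler_addgt0Pr => e e0.
pose B := (x1 - x0) ^+ 2 + 1.
have B0 : 0 < B by rewrite /B; have := sqr_ge0 (x1 - x0); lra.
pose k := e / B; have k0 : 0 < k by rewrite divr_gt0.
pose v w := complex.Im (G w) + k * (complex.Re w - x0) ^+ 2.
have [|z zr zmax] := @rect_max v _ _ _ _ hx hy.
  move=> z zr; apply: cont_atD; last exact: cont_at_Resqr.
  by apply: cont_atIm; apply: jetW (jG _ zr).
have w1z : complex.Im (G w1) <= v z.
  apply: le_trans (zmax _ w1r).
  by rewrite /v lerDl mulr_ge0 ?sqr_ge0 // ltW.
rewrite (le_trans w1z) //.
have [bd|nbd] := pselect [\/ complex.Re z = x0, complex.Re z = x1,
         complex.Im z = y0 | complex.Im z = y1].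
  rewrite /v lerD ?GK // /k -mulrA ler_piMr //; first exact: ltW.
  rewrite mulrC ler_pdivrMr // mul1r.
  case: zr => /andP[h1 h2] _.
  have : (complex.Re z - x0) ^+ 2 <= (x1 - x0) ^+ 2.
    by rewrite lerXn2r ?nnegrE ?subr_ge0 ?lerB.
  by rewrite /B; lra.
exfalso; case: (zr) => /andP[xa xb] /andP[ya yb].
have {}xa : x0 < complex.Re z.
  by rewrite lt_neqAle xa andbT; apply/eqP => h; apply: nbd; constructor 1.
have {}xb : complex.Re z < x1.
  by rewrite lt_neqAle xb andbT; apply/eqP => h; apply: nbd; constructor 2.
have {}ya : y0 < complex.Im z.
  by rewrite lt_neqAle ya andbT; apply/eqP => h; apply: nbd; constructor 3.
have {}yb : complex.Im z < y1.
  by rewrite lt_neqAle yb andbT; apply/eqP => h; apply: nbd; constructor 4.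
have [g1 [[g2 [[g3 [[M [r [r0 g3M]]] [r1 [r10 g2E]]]] [r2 [r20 g1E]]]]
  [r3 [r30 GE]]]] := jG _ zr.
have M0 : 0 <= M.
  by rewrite (le_trans (cmod_ge0 (g3 z))) // g3M // subrr cmod0.
pose X := complex.Re z; pose Y := complex.Im z.
pose t := Num.min (Num.min (r / 2) (Num.min (r1 / 2) (Num.min (r2 / 2) (r3 / 2))))
  (Num.min (Num.min (X - x0) (x1 - X)) (Num.min (Num.min (Y - y0) (y1 - Y))
     (k / (2 * M + 1)))).
have M1 : 0 < 2 * M + 1 by lra.
have t0 : 0 < t.
  by rewrite !lt_min !divr_gt0 // /X /Y !subr_gt0 xa xb ya yb.
have : t <= t by [].
rewrite {2}/t !le_min => /andP[/and4P[tr tr1 tr2 tr3]].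
move=> /andP[/andP[tx0 tx1]] /andP[/andP[ty0 ty1] tk].
have u4 (o : R[i]) : cmod o = 1 -> cmod (z + o * t%:C - z) = t.
  by move=> o1; rewrite addrC addKr cmodM o1 mul1r cmod_real gtr0_norm.
have Gexp (o : R[i]) : cmod o = 1 -> G (z + o * t%:C) =
    G z + o * (t%:C * g1 z) + o ^+ 2 * (t%:C ^+ 2 * g2 z) +
    (o * t%:C) ^+ 3 * g3 (z + o * t%:C).
  move=> o1; have ut := u4 o o1.
  have ht : z + o * t%:C - z = o * t%:C by rewrite addrC addKr.
  have w1' : cmod (z + o * t%:C - z) < r1 by rewrite ut; lra.
  have w2' : cmod (z + o * t%:C - z) < r2 by rewrite ut; lra.
  have w3' : cmod (z + o * t%:C - z) < r3 by rewrite ut; lra.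
  rewrite (GE _ w3') (g1E _ w2') (g2E _ w1') ht; ring.
have rem (o : R[i]) : cmod o = 1 ->
    - (M * t ^+ 3) <= complex.Im ((o * t%:C) ^+ 3 * g3 (z + o * t%:C)).
  move=> o1; have := cmodIm ((o * t%:C) ^+ 3 * g3 (z + o * t%:C)).
  rewrite cmodM cmodX cmodM o1 mul1r cmod_real (gtr0_norm t0).
  have : cmod (g3 (z + o * t%:C)) <= M by apply: g3M; rewrite u4 //; lra.
  have t3 : 0 <= t ^+ 3 by rewrite exprn_ge0 // ltW.
  move=> h1 h2; have := ler_wpM2r t3 h1.
  move: h2; rewrite ler_norml => /andP[h2 _]; lra.
have inr (o : R[i]) : `|complex.Re o| <= 1 -> `|complex.Im o| <= 1 ->
    in_rect x0 x1 y0 y1 (z + o * t%:C).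
  rewrite !ler_norml => /andP[a1 a2] /andP[b1 b2].
  have ReE : complex.Re (z + o * t%:C) = X + complex.Re o * t.
    by rewrite cReD cReM /= mulr0 subr0.
  have ImE : complex.Im (z + o * t%:C) = Y + complex.Im o * t.
    by rewrite cImD cImM /= mulr0 add0r.
  have ha1 : - t <= complex.Re o * t by rewrite -mulN1r ler_wpM2r // ltW.
  have ha2 : complex.Re o * t <= t by rewrite ler_piMl // ltW.
  have hb1 : - t <= complex.Im o * t by rewrite -mulN1r ler_wpM2r // ltW.
  have hb2 : complex.Im o * t <= t by rewrite ler_piMl // ltW.
  by split; rewrite ?ReE ?ImE; apply/andP; split; lra.
have n1 : cmod (1 : R[i]) = 1 by rewrite cmod_real normr1.
have n2 : cmod (-1 : R[i]) = 1 by rewrite cmodN.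
have n3 : cmod ('i%C : R[i]) = 1 by rewrite cmodi.
have n4 : cmod (- 'i%C : R[i]) = 1 by rewrite cmodN cmodi.
have r1' : in_rect x0 x1 y0 y1 (z + 1 * t%:C).
  by apply: inr; rewrite /= ?normr1 ?normr0.
have r2' : in_rect x0 x1 y0 y1 (z + (-1) * t%:C).
  by apply: inr; rewrite /= ?oppr0 ?normrN ?normr1 ?normr0.
have r3' : in_rect x0 x1 y0 y1 (z + 'i%C * t%:C).
  by apply: inr; rewrite /= ?normr1 ?normr0.
have r4' : in_rect x0 x1 y0 y1 (z + (- 'i%C) * t%:C).
  by apply: inr; rewrite /= ?oppr0 ?normrN ?normr1 ?normr0.
have e1 := Gexp _ n1; have e2 := Gexp _ n2.
have e3 := Gexp _ n3; have e4 := Gexp _ n4.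
have s1 := rem _ n1; have s2 := rem _ n2.
have s3 := rem _ n3; have s4 := rem _ n4.
have m1 := zmax _ r1'; have m2 := zmax _ r2'.
have m3 := zmax _ r3'; have m4 := zmax _ r4'.
have RE (o : R[i]) : complex.Re (z + o * t%:C) = X + complex.Re o * t.
  by rewrite cReD cReM /= mulr0 subr0.
rewrite /v !RE e1 in m1; rewrite /v !RE e2 in m2.
rewrite /v !RE e3 in m3; rewrite /v !RE e4 in m4.
have i2 : ('i%C : R[i]) ^+ 2 = -1 by exact: sqr_i.
move: m1 m2 m3 m4; rewrite !cImD sqrrN sqrrN i2 expr1n !mul1r !mulN1r !mulNr.
rewrite !cImN /=.
set a1 := complex.Im (t%:C * g1 z); set a2 := complex.Im (_ ^+ 2 * _).
set a3 := complex.Im ('i%C * (t%:C * g1 z)).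
move: s1 s2 s3 s4; rewrite !mul1r !mulN1r !mulNr.
set p1 := complex.Im _; set p2 := complex.Im _.
set p3 := complex.Im _; set p4 := complex.Im _.
move: tk; rewrite ler_pdivlMr // -/X.
move=> tk s1 s2 s3 s4 m1 m2 m3 m4.
have : 2 * k * t ^+ 2 <= 4 * (M * t ^+ 3) by lra.
have -> : 4 * (M * t ^+ 3) = 4 * M * t * t ^+ 2 by ring.
by rewrite (ler_pM2r (exprn_gt0 2 t0)) => h; lra.
Qed.

End MaximumPrinciple.


(** * Growth at the real axis *)

Section BoundaryGrowth.
Context {R : realType}.
Implicit Types (x y : R).

Lemma Im_inv (z : R[i]) : complex.Im (- z^-1) = complex.Im z / cmod z ^+ 2.
Proof.
by rewrite cmod_sqr; case: z => a b; rewrite cImN /= opprK.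
Qed.

Lemma cImZ (k : R) (z : R[i]) : complex.Im (k%:C * z) = k * complex.Im z.
Proof. by rewrite cImM /= mul0r addr0. Qed.

Lemma Im_cube (z : R[i]) : complex.Im (z ^+ 3) =
  3 * complex.Re z ^+ 2 * complex.Im z - complex.Im z ^+ 3.
Proof.
by case: z => a b; rewrite exprSr expr2 !(cImM, cReM) /=; ring.
Qed.

(** A function with values in the closed upper half plane grows at most like
    [1/y] along vertical lines: [g = -1/(f + i)] satisfies [0 < Im g] and
    [|f + i| = 1/|g| <= 1/Im g], and [Im g >= c y] by comparison with the
    harmonic polynomial [q = Im (w - w^3/(2 d^2))] on the rectangle
    [|x - x0| <= d], [0 < y <= d]: [q] is nonpositive on its vertical sides,
    vanishes on the real axis, and is at least [y] above [x0]. *)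
Lemma upper_half_plane_growth (f : R[i] -> R[i]) (x0 d : R) : 0 < d ->
  (forall z, upper_half_plane z -> jet 4 f z) ->
  (forall z, upper_half_plane z -> closed_upper_half_plane (f z)) ->
  exists2 C : R, 0 < C & forall y, 0 < y -> y <= d ->
    cmod (f (x0 +i* y)) <= C / y.
Proof.
move=> d0 fj fI.
pose g w := - (f w + 'i%C)^-1.
have fiI w : upper_half_plane w -> 1 <= complex.Im (f w + 'i%C).
  by move=> /fI; rewrite /closed_upper_half_plane /= cImD /=; lra.
have fi0 w : upper_half_plane w -> f w + 'i%C != 0.
  by move=> /fiI h; apply/eqP => e; rewrite e /= ler10 in h.
have gj w : upper_half_plane w -> jet 3 g w.
  move=> hw; apply: jetN; apply: jetV; last exact: fi0.
  by apply: jetD; [exact: fj|exact: jet_cst].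
have gI w : upper_half_plane w -> 0 < complex.Im (g w).
  move=> hw; rewrite Im_inv divr_gt0 ?exprn_gt0 ?cmod_gt0 ?fi0 //.
  by apply: lt_le_trans (fiI _ hw).
have xx : x0 - d <= x0 + d by lra.
have [|z [zr zi] zmax] := @rect_max _ (fun w => - complex.Im (g w)) _ _ _ _ xx (lexx d).
  move=> z [_]; rewrite -eq_le => /eqP zd.
  have hz : upper_half_plane z by rewrite /upper_half_plane /= -zd.
  rewrite (_ : (fun w => _) = fun w => complex.Im (- g w)); last first.
    by apply/funext => w; rewrite (cImN (g w)).
  by apply: cont_atIm; apply: jetN; apply: jetW (gj _ hz).
have hz : upper_half_plane z.
  by move: zi; rewrite -eq_le => /eqP zd; rewrite /upper_half_plane /= -zd.
pose m := complex.Im (g z); have m0 : 0 < m by exact: gI.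
pose c := 2 * m / (3 * d).
have c0 : 0 < c by rewrite divr_gt0 // mulr_gt0.
have cd : c * (3 / 2 * d) = m by rewrite /c; field; rewrite gt_eqF.
pose k := (2 * d ^+ 2)^-1.
have k0 : 0 < k by rewrite invr_gt0 mulr_gt0 // exprn_gt0.
have kd : k * (2 * d ^+ 2) = 1 by rewrite mulVf // mulf_neq0 // expf_neq0 // gt_eqF.
pose q (s y : R) := y - k * (3 * s ^+ 2 * y - y ^+ 3).
pose G w := c%:C * ((w - x0%:C) - k%:C * (w - x0%:C) ^+ 3) - g w.
have GI w : complex.Im (G w) =
    c * q (complex.Re w - x0) (complex.Im w) - complex.Im (g w).
  rewrite /G cImD cImN; congr (_ - _).
  by rewrite cImZ cImD cImN cImZ Im_cube /q cImD cReD cImN cReN /= subr0.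
have qle s y : 0 < y -> y <= d -> q s y <= 3 / 2 * y.
  move=> y0 yd; rewrite /q; have y0' := ltW y0; have d0' := ltW d0.
  have h1 : 0 <= k * (s ^+ 2 * y).
    by apply: mulr_ge0; [exact: ltW|exact: mulr_ge0 (sqr_ge0 _) y0'].
  have h2 : y ^+ 3 <= d ^+ 2 * y.
    by rewrite exprSr ler_wpM2r // lerXn2r ?nnegrE.
  by have := ler_wpM2l (ltW k0) h2; nra.
have grow eta y : 0 < eta -> eta <= y -> y <= d ->
    c * y <= complex.Im (g (x0 +i* y)) + 3 / 2 * c * eta.
  move=> e0 ey yd.
  have up w : in_rect (x0 - d) (x0 + d) eta d w -> upper_half_plane w.
    by move=> [_ /andP[h _]]; rewrite /upper_half_plane /=; lra.
  have K0 : 0 <= 3 / 2 * c * eta by rewrite ltW // mulr_gt0 // mulr_gt0 // divr_gt0.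
  have jG w : in_rect (x0 - d) (x0 + d) eta d w -> jet 3 G w.
    move=> /up hw; apply: jetB; last exact: gj.
    have jid : jet 3 (fun w => w - x0%:C) w.
      by apply: jetB; [exact: jet_id|exact: jet_cst].
    apply: jetM; first exact: jet_cst.
    by apply: jetB => //; apply: jetM; [exact: jet_cst|exact: jetX].
  have bG w : in_rect (x0 - d) (x0 + d) eta d w ->
      [\/ complex.Re w = x0 - d, complex.Re w = x0 + d,
          complex.Im w = eta | complex.Im w = d] ->
      complex.Im (G w) <= 3 / 2 * c * eta.
    move=> wr; have hw := up _ wr; have gw := gI _ hw.
    case: wr => /andP[a1 a2] /andP[b1 b2]; rewrite GI.
    have b0 : 0 < complex.Im w by exact: hw.
    have side s : s ^+ 2 = d ^+ 2 -> c * q s (complex.Im w) <= 0.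
      move=> sd; rewrite mulr_ge0_le0 ?(ltW c0) // /q sd.
      have h : (complex.Im w) ^+ 3 <= d ^+ 2 * complex.Im w.
        by rewrite exprSr ler_wpM2r ?(ltW b0) // lerXn2r ?nnegrE ?(ltW b0) ?(ltW d0).
      by have := ler_wpM2l (ltW k0) h; nra.
    case=> hb.
    + have := side (complex.Re w - x0); rewrite hb => h.
      by have := h ltac:(ring); lra.
    + have := side (complex.Re w - x0); rewrite hb => h.
      by have := h ltac:(ring); lra.
    + have := ler_wpM2l (ltW c0) (qle (complex.Re w - x0) _ b0 b2).
      by rewrite {2}hb; lra.
    + have h1 := ler_wpM2l (ltW c0) (qle (complex.Re w - x0) _ b0 b2).
      rewrite {2}hb cd in h1.
      have : in_rect (x0 - d) (x0 + d) d d w by split; rewrite ?a1 ?hb ?lexx.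
      by move=> /zmax; rewrite lerN2 -/m; lra.
  have yr : in_rect (x0 - d) (x0 + d) eta d (x0 +i* y).
    by split; apply/andP; split => //=; lra.
  have := max_principle xx (le_trans ey yd) jG bG yr.
  rewrite GI /= subrr => h.
  have : y <= q 0 y.
    rewrite /q expr0n /= mulr0 mul0r sub0r mulrN opprK lerDl mulr_ge0 ?(ltW k0) //.
    by rewrite exprn_ge0 //; lra.
  by move=> /(ler_wpM2l (ltW c0)); lra.
have cy y : 0 < y -> y <= d -> c * y <= complex.Im (g (x0 +i* y)).
  move=> y0 yd; apply/ler_addgt0Pr => e e0.
  pose eta := Num.min y (e / (3 / 2 * c)).
  have c32 : 0 < 3 / 2 * c by rewrite mulr_gt0 // divr_gt0.
  have eta0 : 0 < eta by rewrite lt_min y0 divr_gt0.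
  have etay : eta <= y by rewrite ge_min lexx.
  have etae : 3 / 2 * c * eta <= e.
    by rewrite mulrC -ler_pdivlMr // ge_min lexx orbT.
  by have := grow eta y eta0 etay yd; lra.
exists (c^-1 + d); first by rewrite addr_gt0 ?invr_gt0.
move=> y y0 yd; have hy : upper_half_plane (x0 +i* y) by exact: y0.
have cy0 : 0 < c * y by rewrite mulr_gt0.
have F0 : 0 < cmod (f (x0 +i* y) + 'i%C) by rewrite cmod_gt0 fi0.
have Fle : cmod (f (x0 +i* y) + 'i%C) <= (c * y)^-1.
  rewrite -[leLHS]invrK lef_pV2 ?posrE ?invr_gt0 // -cmodV.
  rewrite (le_trans (cy _ y0 yd)) // -cmodN.
  by rewrite (le_trans _ (cmodIm _)) // ler_norm.
have : cmod (f (x0 +i* y)) <= cmod (f (x0 +i* y) + 'i%C) + 1.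
  by have := cmod_triangleB (f (x0 +i* y) + 'i%C) 'i%C; rewrite addrK cmodi.
move=> /le_trans; apply; rewrite mulrDl -invfM lerD //.
by rewrite ler_pdivlMr // mul1r.
Qed.

End BoundaryGrowth.

(** * Cauchy integrals along a square *)

Section ContourIdentity.
Context {R : realType}.
Notation leb := (@lebesgue_measure R).
Implicit Types (F G : R[i] -> R[i]) (z w : R[i]) (tau d : R).

(** The contour integral over the square of half-side [d] centred at [tau] is the
    sum of [outer_up] and [outer_down]; each adds the segment on the real axis,
    in opposite directions, to become the integral over one half of it. *)
Definition outer_up tau d F : R[i] :=
  'i%C * vert_int F (tau + d) 0 d - horiz_int F d (tau - d) (tau + d)
  - 'i%C * vert_int F (tau - d) 0 d.

Definition outer_down tau d F : R[i] :=
  horiz_int F (- d) (tau - d) (tau + d) + 'i%C * vert_int F (tau + d) (- d) 0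
  - 'i%C * vert_int F (tau - d) (- d) 0.

Lemma rect_int_up tau d F : rect_int F (tau - d) (tau + d) 0 d =
  horiz_int F 0 (tau - d) (tau + d) + outer_up tau d F.
Proof. by rewrite /rect_int /outer_up; ring. Qed.

Lemma rect_int_down tau d F : rect_int F (tau - d) (tau + d) (- d) 0 =
  outer_down tau d F - horiz_int F 0 (tau - d) (tau + d).
Proof. by rewrite /rect_int /outer_down; ring. Qed.

Definition ckernel z w : R[i] := (w - z)^-1.

Lemma jet_kernel n z w : w != z -> jet n (ckernel z) w.
Proof.
move=> wz; apply: jetV; last by rewrite subr_eq0.
by apply: jetB; [exact: jet_id|exact: jet_cst].
Qed.

Definition side_up tau d : set R[i] := [set w |
  [/\ tau - d <= complex.Re w <= tau + d, 0 <= complex.Im w <= d &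
  [\/ complex.Re w = tau + d, complex.Im w = d | complex.Re w = tau - d]]].

Definition side_down tau d : set R[i] := [set w |
  [/\ tau - d <= complex.Re w <= tau + d, - d <= complex.Im w <= 0 &
  [\/ complex.Re w = tau + d, complex.Im w = - d | complex.Re w = tau - d]]].

Lemma side_up_far tau d w : 0 < d -> side_up tau d w -> d <= cmod (w - tau%:C).
Proof.
move=> d0 [_ _ h].
have := cmodRe (w - tau%:C); have := cmodIm (w - tau%:C).
rewrite cImD cReD cImN cReN /= subr0.
case: h => ->.
- by rewrite [_ + _ - _]addrAC subrr add0r (gtr0_norm d0).
- by rewrite (gtr0_norm d0).
- by rewrite [_ - _ - _]addrAC subrr add0r normrN (gtr0_norm d0).
Qed.

Lemma side_down_far tau d w : 0 < d -> side_down tau d w ->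
  d <= cmod (w - tau%:C).
Proof.
move=> d0 [_ _ h].
have := cmodRe (w - tau%:C); have := cmodIm (w - tau%:C).
rewrite cImD cReD cImN cReN /= subr0.
case: h => ->.
- by rewrite [_ + _ - _]addrAC subrr add0r (gtr0_norm d0).
- by rewrite normrN (gtr0_norm d0).
- by rewrite [_ - _ - _]addrAC subrr add0r normrN (gtr0_norm d0).
Qed.

Section Outer.
Context (tau d : R) (d0 : 0 < d).

Let ab : tau - d <= tau + d. Proof. by have := d0; lra. Qed.

Lemma outer_up_cintegrable F : (forall w, side_up tau d w -> jet 1 F w) ->
  [/\ cintegrable leb `[0, d] (fun t => F ((tau + d) +i* t)),
      cintegrable leb `[tau - d, tau + d] (fun t => F (t +i* d)) &
      cintegrable leb `[0, d] (fun t => F ((tau - d) +i* t))].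
Proof.
move=> Fj; split.
- apply: cintegrable_v => y hy; apply: Fj; split => //=; last by constructor 1.
  by rewrite lexx ab.
- apply: cintegrable_h => x hx; apply: Fj; split => //=; last by constructor 2.
  by rewrite lexx ltW.
- apply: cintegrable_v => y hy; apply: Fj; split => //=; last by constructor 3.
  by rewrite lexx ab.
Qed.

Lemma outer_down_cintegrable F : (forall w, side_down tau d w -> jet 1 F w) ->
  [/\ cintegrable leb `[- d, 0] (fun t => F ((tau + d) +i* t)),
      cintegrable leb `[tau - d, tau + d] (fun t => F (t +i* - d)) &
      cintegrable leb `[- d, 0] (fun t => F ((tau - d) +i* t))].
Proof.
move=> Fj; split.
- apply: cintegrable_v => y hy; apply: Fj; split => //=; last by constructor 1.
  by rewrite lexx ab.
- apply: cintegrable_h => x hx; apply: Fj; split => //=; last by constructor 2.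
  by rewrite lexx oppr_le0 ltW.
- apply: cintegrable_v => y hy; apply: Fj; split => //=; last by constructor 3.
  by rewrite lexx ab.
Qed.

Lemma outer_up_eq F G : (forall w, side_up tau d w -> F w = G w) ->
  outer_up tau d F = outer_up tau d G.
Proof.
move=> FG; rewrite /outer_up; congr (_ * _ - _ - _ * _); apply: eq_cint => t /=;
  rewrite in_itv /= => ht; apply: FG; split => //=.
- by rewrite lexx ab.
- by constructor 1.
- by rewrite lexx ltW.
- by constructor 2.
- by rewrite lexx ab.
- by constructor 3.
Qed.

Lemma outer_up_lincomb F G c : (forall w, side_up tau d w -> jet 1 F w) ->
  (forall w, side_up tau d w -> jet 1 G w) ->
  outer_up tau d (fun w => F w + c * G w) =
  outer_up tau d F + c * outer_up tau d G.
Proof.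
move=> /outer_up_cintegrable [f1 f2 f3] /outer_up_cintegrable [g1 g2 g3].
rewrite /outer_up /horiz_int /vert_int !cintD // ?cintZ //; try exact: cintegrableZ.
by ring.
Qed.

Lemma outer_down_lincomb F G c : (forall w, side_down tau d w -> jet 1 F w) ->
  (forall w, side_down tau d w -> jet 1 G w) ->
  outer_down tau d (fun w => F w + c * G w) =
  outer_down tau d F + c * outer_down tau d G.
Proof.
move=> /outer_down_cintegrable [f1 f2 f3] /outer_down_cintegrable [g1 g2 g3].
rewrite /outer_down /horiz_int /vert_int !cintD // ?cintZ //; try exact: cintegrableZ.
by ring.
Qed.

Lemma outer_up_cmod_le F K : 0 <= K ->
  (forall w, side_up tau d w -> jet 1 F w) ->
  (forall w, side_up tau d w -> cmod (F w) <= K) ->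
  cmod (outer_up tau d F) <= 8 * d * K.
Proof.
move=> K0 /outer_up_cintegrable [f1 f2 f3] FK; rewrite /outer_up.
set a := vert_int _ _ _ _; set b := horiz_int _ _ _ _; set c := vert_int _ _ _ _.
have ha : cmod a <= 2 * (K * (d - 0)).
  apply: cmod_cint_seg_le; rewrite ?(ltW d0) // => t ht; apply: FK.
  by split => //=; [rewrite lexx ab|constructor 1].
have hb : cmod b <= 2 * (K * ((tau + d) - (tau - d))).
  apply: cmod_cint_seg_le => // t ht; apply: FK.
  by split => //=; [rewrite lexx ltW|constructor 2].
have hc : cmod c <= 2 * (K * (d - 0)).
  apply: cmod_cint_seg_le; rewrite ?(ltW d0) // => t ht; apply: FK.
  by split => //=; [rewrite lexx ab|constructor 3].
have h1 := cmod_triangleB ('i%C * a - b) ('i%C * c).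
have h2 := cmod_triangleB ('i%C * a) b.
by move: h1 h2; rewrite !cmodM !cmodi !mul1r => h1 h2; lra.
Qed.

Lemma outer_down_cmod_le F K : 0 <= K ->
  (forall w, side_down tau d w -> jet 1 F w) ->
  (forall w, side_down tau d w -> cmod (F w) <= K) ->
  cmod (outer_down tau d F) <= 8 * d * K.
Proof.
move=> K0 /outer_down_cintegrable [f1 f2 f3] FK; rewrite /outer_down.
set b := horiz_int _ _ _ _; set a := vert_int _ _ _ _; set c := vert_int _ _ _ _.
have ha : cmod a <= 2 * (K * (0 - - d)).
  apply: cmod_cint_seg_le; rewrite ?oppr_le0 ?(ltW d0) // => t ht; apply: FK.
  by split => //=; [rewrite lexx ab|constructor 1].
have hb : cmod b <= 2 * (K * ((tau + d) - (tau - d))).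
  apply: cmod_cint_seg_le => // t ht; apply: FK.
  by split => //=; [rewrite lexx oppr_le0 ltW|constructor 2].
have hc : cmod c <= 2 * (K * (0 - - d)).
  apply: cmod_cint_seg_le; rewrite ?oppr_le0 ?(ltW d0) // => t ht; apply: FK.
  by split => //=; [rewrite lexx ab|constructor 3].
have h1 := cmod_triangleB (b + 'i%C * a) ('i%C * c).
have h2 := cmod_triangle b ('i%C * a).
by move: h1 h2; rewrite !cmodM !cmodi !mul1r => h1 h2; lra.
Qed.

Lemma far_neq z w : cmod (z - tau%:C) < d / 2 -> d <= cmod (w - tau%:C) ->
  d / 2 <= cmod (w - z) /\ w != z.
Proof.
move=> h1 h2; have h3 := cmod_triangle (w - z) (z - tau%:C).
have e : w - z + (z - tau%:C) = w - tau%:C by ring.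
rewrite e in h3; have h4 : d / 2 <= cmod (w - z) by lra.
split=> //; rewrite -subr_eq0 -cmod_gt0; apply: lt_le_trans h4.
by rewrite divr_gt0.
Qed.

Lemma kernel_lip z z' w : cmod (z - tau%:C) < d / 2 ->
  cmod (z' - tau%:C) < d / 2 -> d <= cmod (w - tau%:C) ->
  cmod (ckernel z w - ckernel z' w) <= (2 / d) ^+ 2 * cmod (z - z').
Proof.
move=> hz hz' hw; have [h1 n1] := far_neq hz hw; have [h2 n2] := far_neq hz' hw.
have d2 : 0 < d / 2 by rewrite divr_gt0.
have -> : ckernel z w - ckernel z' w = (z - z') * ((w - z)^-1 * (w - z')^-1).
  by rewrite /ckernel; field; rewrite !subr_eq0 n1 n2.
rewrite !cmodM !cmodV mulrC ler_wpM2r ?cmod_ge0 // expr2.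
have -> : 2 / d = (d / 2)^-1 by rewrite invf_div.
by rewrite ler_pM ?invr_ge0 ?cmod_ge0 // lef_pV2 ?posrE // ?(lt_le_trans d2).
Qed.

(** The kernel stays bounded on the outer sides while [z] moves near [tau], so
    that Cauchy integrals along them are Lipschitz in [z]. *)
Lemma outer_up_lip F M z z' : 0 <= M ->
  (forall w, side_up tau d w -> jet 1 F w) ->
  (forall w, side_up tau d w -> cmod (F w) <= M) ->
  cmod (z - tau%:C) < d / 2 -> cmod (z' - tau%:C) < d / 2 ->
  cmod (outer_up tau d (fun w => F w * ckernel z w) -
        outer_up tau d (fun w => F w * ckernel z' w)) <= 32 / d * M * cmod (z - z').
Proof.
move=> M0 Fj FM hz hz'.
have jk u : cmod (u - tau%:C) < d / 2 -> forall w, side_up tau d w ->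
    jet 1 (fun w => F w * ckernel u w) w.
  move=> hu w sw; apply: jetM; first exact: Fj.
  by apply: jet_kernel; have [] := far_neq hu (side_up_far d0 sw).
rewrite -mulN1r -outer_up_lincomb; [|exact: jk..].
have -> : 32 / d * M * cmod (z - z') =
    8 * d * (M * ((2 / d) ^+ 2 * cmod (z - z'))).
  by field; rewrite gt_eqF.
apply: outer_up_cmod_le.
- by rewrite mulr_ge0 // mulr_ge0 ?sqr_ge0 ?cmod_ge0.
- move=> w sw; apply: jetD; first exact: jk.
  by apply: jetM; [exact: jet_cst|exact: jk].
- move=> w sw; rewrite mulN1r -mulrBr cmodM.
  by rewrite ler_pM ?cmod_ge0 ?FM // kernel_lip // side_up_far.
Qed.

Lemma outer_down_lip F M z z' : 0 <= M ->
  (forall w, side_down tau d w -> jet 1 F w) ->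
  (forall w, side_down tau d w -> cmod (F w) <= M) ->
  cmod (z - tau%:C) < d / 2 -> cmod (z' - tau%:C) < d / 2 ->
  cmod (outer_down tau d (fun w => F w * ckernel z w) -
        outer_down tau d (fun w => F w * ckernel z' w)) <=
    32 / d * M * cmod (z - z').
Proof.
move=> M0 Fj FM hz hz'.
have jk u : cmod (u - tau%:C) < d / 2 -> forall w, side_down tau d w ->
    jet 1 (fun w => F w * ckernel u w) w.
  move=> hu w sw; apply: jetM; first exact: Fj.
  by apply: jet_kernel; have [] := far_neq hu (side_down_far d0 sw).
rewrite -mulN1r -outer_down_lincomb; [|exact: jk..].
have -> : 32 / d * M * cmod (z - z') =
    8 * d * (M * ((2 / d) ^+ 2 * cmod (z - z'))).
  by field; rewrite gt_eqF.
apply: outer_down_cmod_le.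
- by rewrite mulr_ge0 // mulr_ge0 ?sqr_ge0 ?cmod_ge0.
- move=> w sw; apply: jetD; first exact: jk.
  by apply: jetM; [exact: jet_cst|exact: jk].
- move=> w sw; rewrite mulN1r -mulrBr cmodM.
  by rewrite ler_pM ?cmod_ge0 ?FM // kernel_lip // side_down_far.
Qed.

(** [2 i pi] times the winding number of the square around [z].  The argument uses
    of it that it is Lipschitz near [tau] and nonzero at [tau]. *)
Definition winding z : R[i] :=
  outer_up tau d (ckernel z) + outer_down tau d (ckernel z).

Lemma winding_lip z z' :
  cmod (z - tau%:C) < d / 2 -> cmod (z' - tau%:C) < d / 2 ->
  cmod (winding z - winding z') <= 64 / d * cmod (z - z').
Proof.
move=> hz hz'.
have one w : cmod ((fun=> 1 : R[i]) w) <= 1 by rewrite cmod_real normr1.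
have k1 u : ckernel u = (fun w => (fun=> 1) w * ckernel u w).
  by apply/funext => w; rewrite mul1r.
have h1 := @outer_up_lip (fun=> 1) 1 z z' ler01 (fun w _ => jet_cst 1 1 w)
  (fun w _ => one w) hz hz'.
have h2 := @outer_down_lip (fun=> 1) 1 z z' ler01 (fun w _ => jet_cst 1 1 w)
  (fun w _ => one w) hz hz'.
rewrite -!k1 in h1 h2; rewrite /winding opprD addrACA.
have -> : 64 / d * cmod (z - z') =
  32 / d * 1 * cmod (z - z') + 32 / d * 1 * cmod (z - z') by ring.
by rewrite (le_trans (cmod_triangle _ _)) // lerD.
Qed.

Lemma kernelE (w : R[i]) :
  w^-1 = (complex.Re w / cmod w ^+ 2) +i* (- complex.Im w / cmod w ^+ 2).
Proof. by rewrite cmod_sqr; case: w => a b /=; rewrite mulNr. Qed.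

(** Every side of the square is traversed with [tau] on its left, so it
    contributes a nonnegative argument variation. *)
Lemma winding_neq0 : winding tau%:C != 0.
Proof.
have d0' := ltW d0.
have kRe (t : R) : complex.Re (ckernel tau%:C ((tau + d) +i* t)) =
    d / (d ^+ 2 + t ^+ 2).
  by rewrite /ckernel kernelE cmod_sqr /= subr0 [_ + _ - _]addrAC subrr add0r.
have kRe' (t : R) : complex.Re (ckernel tau%:C ((tau - d) +i* t)) =
    - d / (d ^+ 2 + t ^+ 2).
  rewrite /ckernel kernelE cmod_sqr /= subr0 [_ - _ - _]addrAC subrr add0r.
  by rewrite sqrrN.
have kIm (t s : R) : complex.Im (ckernel tau%:C (t +i* s)) =
    - s / ((t - tau) ^+ 2 + s ^+ 2).
  by rewrite /ckernel kernelE cmod_sqr /= subr0.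
have pos (t : R) : 0 <= d / (d ^+ 2 + t ^+ 2).
  by rewrite divr_ge0 // addr_ge0 ?sqr_ge0.
have nk w : side_up tau d w -> jet 1 (ckernel tau%:C) w.
  move=> sw; apply: jet_kernel; rewrite -subr_eq0 -cmod_gt0.
  exact: lt_le_trans (side_up_far d0 sw).
have [i1 i2 i3] := outer_up_cintegrable nk.
have nk' w : side_down tau d w -> jet 1 (ckernel tau%:C) w.
  move=> sw; apply: jet_kernel; rewrite -subr_eq0 -cmod_gt0.
  exact: lt_le_trans (side_down_far d0 sw).
have [j1 j2 j3] := outer_down_cintegrable nk'.
have Nd0 : - d <= 0 by rewrite oppr_le0.
have a1 : (2 * d)^-1 * (d - 0) <=
    complex.Re (vert_int (ckernel tau%:C) (tau + d) 0 d).
  apply: Rintegral_seg_ge => //; first by case: i1.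
  move=> t /andP[t0 td]; rewrite kRe.
  have td2 : t ^+ 2 <= d ^+ 2 by rewrite lerXn2r ?nnegrE.
  have dd : 0 < d ^+ 2 by rewrite exprn_gt0.
  have dt : 0 < d ^+ 2 + t ^+ 2 by rewrite ltr_pwDl // sqr_ge0.
  rewrite ler_pdivlMr // mulrC ler_pdivrMr ?mulr_gt0 //.
  by rewrite mulrCA -expr2; lra.
have a2 : complex.Re (vert_int (ckernel tau%:C) (tau - d) 0 d) <= 0 * (d - 0).
  apply: Rintegral_seg_le => //; first by case: i3.
  by move=> t _; rewrite kRe' mulNr oppr_le0.
have a3 : complex.Im (horiz_int (ckernel tau%:C) d (tau - d) (tau + d)) <=
    0 * (tau + d - (tau - d)).
  apply: Rintegral_seg_le => //; first by case: i2.
  by move=> t _; rewrite kIm mulNr oppr_le0 divr_ge0 // addr_ge0 ?sqr_ge0.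
have a4 : 0 * (tau + d - (tau - d)) <=
    complex.Im (horiz_int (ckernel tau%:C) (- d) (tau - d) (tau + d)).
  apply: Rintegral_seg_ge => //; first by case: j2.
  by move=> t _; rewrite kIm opprK divr_ge0 // addr_ge0 ?sqr_ge0.
have a5 : 0 * (0 - - d) <= complex.Re (vert_int (ckernel tau%:C) (tau + d) (- d) 0).
  apply: Rintegral_seg_ge => //; first by case: j1.
  by move=> t _; rewrite kRe.
have a6 : complex.Re (vert_int (ckernel tau%:C) (tau - d) (- d) 0) <= 0 * (0 - - d).
  apply: Rintegral_seg_le => //; first by case: j3.
  by move=> t _; rewrite kRe' mulNr oppr_le0.
have a0 : 0 < (2 * d)^-1 * (d - 0).
  by rewrite subr0 mulr_gt0 // invr_gt0 mulr_gt0.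
suff : 0 < complex.Im (winding tau%:C).
  by apply: contraTN => /eqP ->; rewrite /= ltxx.
have ImE (v1 h1 v2 h2 v3 v4 : R[i]) :
    complex.Im ('i%C * v1 - h1 - 'i%C * v2 + (h2 + 'i%C * v3 - 'i%C * v4)) =
    complex.Re v1 - complex.Im h1 - complex.Re v2 +
    (complex.Im h2 + complex.Re v3 - complex.Re v4).
  by rewrite !(cImD, cImN, cImM) /= !mul0r !mul1r !add0r.
move: a1 a2 a3 a4 a5 a6 a0; rewrite /winding /outer_up /outer_down ImE !mul0r.
move: ((2 * d)^-1 * _) (complex.Re _) (complex.Re _) (complex.Im _).
move=> e r1 r2 r3; move: (complex.Im _) (complex.Re _) (complex.Re _).
by move=> r4 r5 r6 *; lra.
Qed.

End Outer.

End ContourIdentity.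

(** * Representation near a boundary point *)

Section LocalRepresentation.
Context {R : realType}.
Notation leb := (@lebesgue_measure R).
Context (tau d : R) (d0 : 0 < d).
Implicit Types (g h f : R[i] -> R[i]) (z w : R[i]).

Let ab : tau - d <= tau + d. Proof. by have := d0; lra. Qed.

(** Cauchy's formula on the two halves of the square, with [g] above the real
    axis and [h] below it.  The point [z] lies in the upper half, so [g z] may be
    subtracted from both functions without creating a pole below; the four
    integrals over the common side combine into that of the jump [g - h]. *)
Lemma contour_identity g h z :
  cmod (z - tau%:C) < d / 2 -> upper_half_plane z ->
  (forall w, in_rect (tau - d) (tau + d) 0 d w -> jet 3 g w) ->
  (forall w, in_rect (tau - d) (tau + d) (- d) 0 w -> jet 3 h w) ->
  g z * winding tau d z =
  horiz_int (fun w => (g w - h w) * ckernel z w) 0 (tau - d) (tau + d) +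
  (outer_up tau d (fun w => g w * ckernel z w) +
   outer_down tau d (fun w => h w * ckernel z w)).
Proof.
move=> hz zup gj hj; have d0' := ltW d0; have Nd0 : - d <= 0 by rewrite oppr_le0.
have zr : in_rect (tau - d) (tau + d) 0 d z.
  have := cmodRe (z - tau%:C); have := cmodIm (z - tau%:C).
  rewrite cImD cReD cImN cReN /= subr0 !ler_norml.
  move=> /andP[h1 h2] /andP[h3 h4]; have z0 : 0 < complex.Im z by [].
  by split; apply/andP; split; lra.
have [E [Ez Ejz Ej]] := jet_divdiff (gj _ zr) gj.
have {Ez}Ez w : w != z -> E w = g w * ckernel z w + - g z * ckernel z w.
  by move=> /Ez ->; rewrite -mulrDl.
pose E' w := h w * ckernel z w + - g z * ckernel z w.
have low w : in_rect (tau - d) (tau + d) (- d) 0 w -> w != z.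
  move=> [_ /andP[_ w0]]; apply/eqP => wz; move: w0; rewrite wz leNgt.
  by have -> : 0 < complex.Im z by [].
have E'j w : in_rect (tau - d) (tau + d) (- d) 0 w -> jet 2 E' w.
  move=> wr; have jk := jet_kernel 2 (low _ wr).
  apply: jetD; first by apply: jetM => //; exact: jetW (hj _ wr).
  by apply: jetM => //; exact: jet_cst.
have jE : jet_rect 2 E (tau - d) (tau + d) 0 d by move=> x y hx hy; exact: Ej.
have jE' : jet_rect 2 E' (tau - d) (tau + d) (- d) 0.
  by move=> x y hx hy; exact: E'j.
have := goursat ab d0' jE; rewrite rect_int_up => up0.
have := goursat ab Nd0 jE'; rewrite rect_int_down => down0.
have sur w : side_up tau d w -> in_rect (tau - d) (tau + d) 0 d w.
  by case=> h1 h2 _; split.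
have sdr w : side_down tau d w -> in_rect (tau - d) (tau + d) (- d) 0 w.
  by case=> h1 h2 _; split.
have suz w : side_up tau d w -> w != z.
  by move=> sw; have [] := far_neq d0 hz (side_up_far d0 sw).
have outE : outer_up tau d E = outer_up tau d (fun w => g w * ckernel z w) +
    - g z * outer_up tau d (ckernel z).
  rewrite -outer_up_lincomb //.
  - by apply: outer_up_eq => // w sw; rewrite Ez // suz.
  - move=> w sw; apply: jetM; first by apply: jetW (gj _ (sur _ sw)).
    exact: jet_kernel (suz _ sw).
  - by move=> w sw; exact: jet_kernel (suz _ sw).
have outE' : outer_down tau d E' =
    outer_down tau d (fun w => h w * ckernel z w) +
    - g z * outer_down tau d (ckernel z).
  rewrite -outer_down_lincomb // => w sw; have wz := low _ (sdr _ sw).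
    apply: jetM; first by apply: jetW (hj _ (sdr _ sw)).
    exact: jet_kernel.
  exact: jet_kernel.
have hE : horiz_int E 0 (tau - d) (tau + d) - horiz_int E' 0 (tau - d) (tau + d) =
    horiz_int (fun w => (g w - h w) * ckernel z w) 0 (tau - d) (tau + d).
  rewrite /horiz_int -cintB //.
  - apply: eq_cint => t /=; rewrite in_itv /= => ht.
    have tz : t +i* 0 != z by apply: low; split; rewrite /= ?Nd0 ?lexx.
    by rewrite Ez // /E'; ring.
  - apply: cintegrable_h => x hx; apply: jetW (jE _ _ hx _) => //.
    by rewrite lexx.
  - apply: cintegrable_h => x hx; apply: jetW (jE' _ _ hx _) => //.
    by rewrite lexx andbT.
rewrite -hE /winding mulrDr.
move: up0 down0; rewrite outE outE'.
set a := horiz_int E _ _ _; set a' := horiz_int E' _ _ _.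
set b := outer_up _ _ _; set k := outer_up _ _ _.
set b' := outer_down _ _ _; set k' := outer_down _ _ _.
move=> up0 down0.
have -> : g z * k = a + b.
  by rewrite -[LHS]add0r -[X in X + _]up0; ring.
have -> : g z * k' = b' - a'.
  by rewrite -[LHS]add0r -[X in X + _]down0; ring.
ring.
Qed.

(** A polynomial vanishing at the two points where the sides of the square cross the
    real axis; it compensates the growth of [f] near them. *)
Definition corner w : R[i] := (d ^+ 2)%:C - (w - tau%:C) ^+ 2.

Lemma jet_corner n w : jet n corner w.
Proof.
apply: jetB; first exact: jet_cst.
by apply: jetX; apply: jetB; [exact: jet_id|exact: jet_cst].
Qed.

Lemma corner_conj w : (corner w^*%C)^*%C = corner w.
Proof.
have cj (a b : R[i]) : (a - b ^+ 2)^*%C = a^*%C - b^*%C ^+ 2.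
  by rewrite rmorphB rmorphXn.
have cb : (w^*%C - tau%:C)^*%C = w - tau%:C.
  by case: w => a b; apply: complex_eq => /=; ring.
by rewrite /corner cj cb conjc_real.
Qed.

Lemma corner_real (t : R) : corner t%:C = (d ^+ 2 - (t - tau) ^+ 2)%:C.
Proof. by rewrite /corner -rmorphB -rmorphXn -rmorphB. Qed.

Lemma corner_side w : (complex.Re w - tau) ^+ 2 = d ^+ 2 ->
  `|complex.Im w| <= d -> cmod (corner w) <= 3 * d * `|complex.Im w|.
Proof.
move=> hs hI; set y := complex.Im w in hI *.
have hre : `|complex.Re w - tau| <= d.
  by rewrite -(ler_pXn2r (ltn0Sn 1)) ?nnegrE ?(ltW d0) // real_normK ?num_real // hs.
have -> : corner w = y%:C * (y%:C - 'i%C * (2 * (complex.Re w - tau))%:C).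
  rewrite /corner -hs; move: @y hs hI hre; case: w => a b /= _ _ _.
  by apply: complex_eq; rewrite ?expr2 !(cImD, cReD, cImN, cReN, cImM, cReM) /=;
    ring.
rewrite cmodM cmod_real mulrC ler_wpM2r //.
rewrite (le_trans (cmod_triangleB _ _)) // cmodM cmodi mul1r !cmod_real.
by rewrite normrM (gtr0_norm (_ : 0 < 2)) //; lra.
Qed.

Lemma corner_bound w : `|complex.Re w - tau| <= d -> `|complex.Im w| <= d ->
  cmod (corner w) <= 5 * d ^+ 2.
Proof.
move=> h1 h2; rewrite /corner (le_trans (cmod_triangleB _ _)) //.
rewrite cmod_real cmodX (ger0_norm (sqr_ge0 _)).
have : cmod (w - tau%:C) <= 2 * d.
  rewrite (le_trans (cmod_le_ReIm _)) // cReD cImD cReN cImN /= subr0; lra.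
move=> h; have : cmod (w - tau%:C) ^+ 2 <= (2 * d) ^+ 2.
  by rewrite lerXn2r ?nnegrE ?cmod_ge0 // mulr_ge0 // ltW.
by rewrite exprMn; lra.
Qed.

Definition jump f (eps : R) z : R[i] :=
  cint leb `[tau - d, tau + d] (fun t =>
    ((d ^+ 2 - (t - tau) ^+ 2) * complex.Im (f (t +i* eps)))%:C * ckernel z t%:C).

(** As [winding] is [2 i pi], this is the formula
    [F = (1/pi) \int Im F / (t - z) + analytic] for [F = corner * f] just above the
    real axis.  The analytic term is the integral of [corner * f] and
    its mirror image along the outer sides of the square, where [corner] offsets
    the growth of [f]; hence a Lipschitz constant independent of [eps]. *)
Lemma local_representation f :
  (forall z, upper_half_plane z -> jet 4 f z) ->
  (forall z, upper_half_plane z -> closed_upper_half_plane (f z)) ->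
  exists2 L, 0 <= L & forall eps, 0 < eps -> eps <= d ->
    forall z z', upper_half_plane z -> upper_half_plane z' ->
    cmod (z - tau%:C) < d / 2 -> cmod (z' - tau%:C) < d / 2 ->
    cmod ((corner z * f (z + 0 +i* eps) * winding tau d z
             - 2 * 'i%C * jump f eps z) -
          (corner z' * f (z' + 0 +i* eps) * winding tau d z'
             - 2 * 'i%C * jump f eps z')) <= L * cmod (z - z').
Proof.
move=> fj fI; have d20 : 0 < 2 * d by rewrite mulr_gt0.
have [C1 C10 C1P] := upper_half_plane_growth (tau - d) d20 fj fI.
have [C2 C20 C2P] := upper_half_plane_growth (tau + d) d20 fj fI.
have dd : d <= 2 * d by have := d0; lra.
have [|zK zKr zKP] := rect_max (v := fun w => cmod (f w)) ab dd.
  move=> w [_ /andP[h _]]; apply: cont_at_cmod; apply: jetW (fj _ _) => //.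
  by rewrite /upper_half_plane /=; apply: lt_le_trans h.
pose K := cmod (f zK); have K0 : 0 <= K by exact: cmod_ge0.
pose M := 3 * d * (C1 + C2) + 5 * d ^+ 2 * K.
have d2K : 0 <= 5 * d ^+ 2 * K by rewrite mulr_ge0 // mulr_ge0 // sqr_ge0.
have d3C : 0 <= 3 * d * (C1 + C2).
  by rewrite ltW // mulr_gt0 ?addr_gt0 ?mulr_gt0.
have M0 : 0 <= M by rewrite addr_ge0.
exists (32 / d * M + 32 / d * M).
  by rewrite addr_ge0 // mulr_ge0 // divr_ge0 // ltW.
move=> eps e0 ed z z' zup zup' hz hz'.
pose c : R[i] := 0 +i* eps.
pose g w := corner w * f (w + c).
pose h w := corner w * (f (w^*%C + c))^*%C.
have gj w : 0 <= complex.Im w -> jet 3 g w.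
  move=> w0; apply: jetM; first exact: jet_corner.
  apply: jet_shift; apply: jetW (fj _ _) => //.
  by rewrite /upper_half_plane /= cImD /=; lra.
have hj w : complex.Im w <= 0 -> jet 3 h w.
  move=> w0; apply: jetM; first exact: jet_corner.
  apply: (@jet_conj _ _ (fun w => f (w + c))).
  apply: jet_shift; apply: jetW (fj _ _) => //.
  rewrite /upper_half_plane /= cImD /=; case: (w) w0 => a b /= b0; lra.
(* Mirror images have equal moduli, so it suffices to bound [g] above. *)
have gM w : side_up tau d w -> cmod (g w) <= M.
  move=> [/andP[x1 x2] /andP[y1 y2] hs]; rewrite cmodM.
  have hw : w + c = complex.Re w +i* (complex.Im w + eps).
    by apply: complex_eq; rewrite ?cReD ?cImD /= ?addr0.
  have ye : 0 < complex.Im w + eps by lra.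
  have ye2 : complex.Im w + eps <= 2 * d by lra.
  have yd : `|complex.Im w| <= d by rewrite ger0_norm.
  have vert C : 0 < C -> cmod (f (w + c)) <= C / (complex.Im w + eps) ->
      (complex.Re w - tau) ^+ 2 = d ^+ 2 ->
      cmod (corner w) * cmod (f (w + c)) <= 3 * d * C.
    move=> C0 fC hd; have := corner_side hd yd; rewrite ger0_norm // => cC.
    rewrite (le_trans (ler_pM _ _ cC fC)) ?cmod_ge0 //.
    rewrite mulrA ler_pdivrMr // -!mulrA ler_wpM2l // ler_wpM2l ?(ltW d0) //.
    by rewrite mulrC ler_wpM2l ?(ltW C0) // lerDl ltW.
  have le1 : 3 * d * C1 <= M.
    have : 0 <= 3 * d * C2 by rewrite ltW // mulr_gt0 // mulr_gt0.
    by rewrite /M; lra.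
  have le2 : 3 * d * C2 <= M.
    have : 0 <= 3 * d * C1 by rewrite ltW // mulr_gt0 // mulr_gt0.
    by rewrite /M; lra.
  case: hs => hs.
  - apply: le_trans le2; apply: vert => //.
      by rewrite hw hs; exact: C2P.
    by rewrite hs; ring.
  - apply: (@le_trans _ _ (5 * d ^+ 2 * K)); last by rewrite lerDr.
    apply: ler_pM; rewrite ?cmod_ge0 //.
      by apply: corner_bound => //; rewrite ler_norml; apply/andP; split; lra.
    by apply: zKP; rewrite hw; split; apply/andP; split => /=; lra.
  - apply: le_trans le1; apply: vert => //.
      by rewrite hw hs; exact: C1P.
    by rewrite hs; ring.
have hM w : side_down tau d w -> cmod (h w) <= M.
  move=> [x y hs]; have -> : h w = (g w^*%C)^*%C.
    by rewrite /g rmorphM /= corner_conj.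
  rewrite cmod_conj; apply: gM; case: w x y hs => a b /= x /andP[y1 y2] hs.
  split => //=; first by apply/andP; split; lra.
  by case: hs => hs; [constructor 1|constructor 2; rewrite hs opprK|constructor 3].
have tc (t : R) : t +i* 0 + c = t +i* eps.
  by apply: complex_eq; rewrite ?cReD ?cImD /= ?addr0 ?add0r.
have gh u t : (g (t +i* 0) - h (t +i* 0)) * ckernel u (t +i* 0) = 2 * 'i%C *
    (((d ^+ 2 - (t - tau) ^+ 2) * complex.Im (f (t +i* eps)))%:C *
      ckernel u t%:C).
  rewrite /g /h complexr0 conjc_real -complexr0 tc complexr0 -mulrBr subcJ.
  by rewrite corner_real rmorphM /=; ring.
have i20 : 2 * 'i%C != 0 :> R[i].
  by rewrite -cmod_gt0 cmodM cmodi mulr1 cmod_gt0 pnatr_eq0.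
have jumpE u : upper_half_plane u ->
    horiz_int (fun w => (g w - h w) * ckernel u w) 0 (tau - d) (tau + d) =
    2 * 'i%C * jump f eps u.
  move=> hu.
  have ci : cintegrable leb `[tau - d, tau + d]
      (fun t => (g (t +i* 0) - h (t +i* 0)) * ckernel u (t +i* 0)).
    apply: (cintegrable_h (E := fun w => (g w - h w) * ckernel u w)) => x _.
    apply: jetM; first by apply: jetB; apply: jetW (gj _ _) || apply: jetW (hj _ _).
    apply: jet_kernel; apply/eqP => xu.
    by move: hu; rewrite -xu /upper_half_plane /= ltxx.
  rewrite /horiz_int /jump -cintZ //.
    by apply: eq_cint => t _; exact: gh.
  apply: (eq_cintegrable _ _ (cintegrableZ (2 * 'i%C)^-1 _ ci)) => // t _.
  by rewrite gh mulKf.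
have SE u : upper_half_plane u -> cmod (u - tau%:C) < d / 2 ->
    corner u * f (u + 0 +i* eps) * winding tau d u - 2 * 'i%C * jump f eps u =
    outer_up tau d (fun w => g w * ckernel u w) +
    outer_down tau d (fun w => h w * ckernel u w).
  move=> hu hud; rewrite -jumpE //.
  have := @contour_identity g h u hud hu; rewrite -[corner u * _]/(g u) => ->.
  - by rewrite addrC addKr.
  - by move=> w [_ /andP[w0 _]]; exact: gj.
  - by move=> w [_ /andP[_ w0]]; exact: hj.
rewrite !SE // opprD addrACA mulrDl (le_trans (cmod_triangle _ _)) // lerD //.
  apply: outer_up_lip => // w [_ /andP[w0 _] _].
  exact: jetW (gj _ w0).
apply: outer_down_lip => // w [_ /andP[_ w0] _].
exact: jetW (hj _ w0).
Qed.

End LocalRepresentation.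

(** * Passage to the boundary measure *)

Section BoundaryMeasure.
Context {R : realType}.
Notation leb := (@lebesgue_measure R).
Context (mu : {measure set (measurableTypeR R) -> \bar R}).
Context (f : R[i] -> R[i]) (mu_f : is_nevanlinna_measure f mu).
Context (tau d : R) (d0 : 0 < d).

Let profile (t : R) := d ^+ 2 - (t - tau) ^+ 2.
Let I : set (measurableTypeR R) := [set` `[tau - d, tau + d]].

Let mI : measurable I. Proof. exact: measurable_itv. Qed.

Let cI : compact (I : set R). Proof. exact: segment_compact. Qed.

Let muI : (mu I < +oo)%E. Proof. by apply: mu_f.1; exact: cI. Qed.

Lemma profile_ge0 t : I t -> 0 <= profile t.
Proof.
rewrite /I /= in_itv /= => /andP[h1 h2].
rewrite /profile subr_ge0 -[leRHS]real_normK ?num_real // (gtr0_norm d0).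
by rewrite -real_normK ?num_real // lerXn2r ?nnegrE ?(ltW d0) // ler_norml;
  apply/andP; split; lra.
Qed.

Lemma profile_le0 t : ~ I t -> profile t <= 0.
Proof.
move=> nI; rewrite /profile subr_le0 -[leRHS]real_normK ?num_real //.
rewrite lerXn2r ?nnegrE ?(ltW d0) // leNgt; apply/negP.
rewrite ltr_norml => /andP[h1 h2]; apply: nI.
by rewrite /I /= in_itv /=; apply/andP; split; lra.
Qed.

Lemma profile_le t : profile t <= d ^+ 2.
Proof. by rewrite /profile gerDl oppr_le0 sqr_ge0. Qed.

Lemma profile_continuous : continuous profile.
Proof.
move=> t; apply: cvgB; first exact: cvg_cst.
by apply: cvgM; (apply: cvgB; [exact: cvg_id|exact: cvg_cst]).
Qed.

(** [profile] cut off outside the interval: as [profile] vanishes at its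
    endpoints, this is a continuous test function. *)
Let cut (t : R) := Num.max 0 (profile t).

Lemma cut_in t : I t -> cut t = profile t.
Proof. by move=> /profile_ge0 h; rewrite /cut; apply/max_idPr. Qed.

Lemma cut_out t : ~ I t -> cut t = 0.
Proof. by move=> /profile_le0 h; rewrite /cut; apply/max_idPl. Qed.

Lemma cut_continuous : continuous cut.
Proof.
move=> t; apply: continuous_max; first exact: cvg_cst.
exact: profile_continuous.
Qed.

Lemma integrable_continuous (u : R -> R) : continuous u ->
  mu.-integrable I (EFin \o u).
Proof.
move=> uc; apply: measurable_bounded_integrable => //.
  by apply: measurable_funTS; exact: continuous_measurable_fun.
have /compact_bounded[M [_ uM]] :=
  continuous_compact (continuous_subspaceT uc) cI.
by exists M; split; rewrite ?num_real // => ? ? ? ?; exact: uM.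
Qed.

Lemma weak_limit (k : R -> R) : continuous k -> forall e, 0 < e ->
  exists delta : R, 0 < delta /\ forall eps, 0 < eps -> eps < delta ->
    `|\int[leb]_(t in `[(tau - d), (tau + d)])
          (profile t * complex.Im (f (t +i* eps)) * k t)
      - \int[mu]_(t in I) (profile t * k t)| < e.
Proof.
move=> kc e e0; pose phi t := cut t * k t.
have phic : continuous phi.
  by move=> t; apply: cvgM; [exact: cut_continuous|exact: kc].
have supp : closure [set x | phi x != 0] `<=` (I : set R).
  have cl : closed (I : set R) by exact: itv_closed.
  rewrite [X in _ `<=` X]((closure_id _).1 cl); apply: closure_subset => x /= xn.
  apply: contrapT => nx; move: xn; apply/negP; rewrite negbK.
  by rewrite /phi cut_out ?mul0r.
have sc : compact (closure [set x | phi x != 0]).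
  by apply: subclosed_compact cI supp; exact: closed_closure.
have := mu_f.2 phi phic sc.
have -> : (\int[mu]_x (phi x)%:E = \int[mu]_(x in I) (profile x * k x)%:E)%E.
  rewrite [RHS]integral_mkcond; apply: eq_integral => x _.
  rewrite patchE; case: ifPn => [/set_mem xI|/negP xI]; first by rewrite /phi cut_in.
  by rewrite /phi cut_out ?mul0r // => xI'; apply: xI; rewrite inE.
rewrite -[X in _ --> X]fineK; last first.
  apply: integrable_fin_num => //; apply: integrable_continuous => t.
  by apply: cvgM; [exact: profile_continuous|exact: kc].
move=> /fine_cvg /cvgrPdist_lt /(_ e e0).
case=> r /= r0 rP; exists r; split=> // eps e1 e2.
have := rP eps; rewrite /ball /= sub0r normrN gtr0_norm // => /(_ e2 e1).
rewrite distrC; congr (`|_ - _| < e); congr fine.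
rewrite [RHS]integral_mkcond; apply: eq_integral => x _.
rewrite patchE; case: ifPn => [/set_mem xI|/negP xI].
  by rewrite /phi cut_in // mulrAC.
by rewrite /phi cut_out ?mul0r // => xI'; apply: xI; rewrite inE.
Qed.

(** The limit of [jump] at the real axis: [profile] is the restriction of [corner]
    to it. *)
Definition cauchy_transform (z : R[i]) : R[i] :=
  cint mu I (fun t => (profile t)%:C * ckernel z t%:C).

Lemma real_neq_upper (t : R) z : upper_half_plane z -> t%:C != z.
Proof.
by rewrite /upper_half_plane /= => z0; apply/eqP => tz; rewrite -tz ltxx in z0.
Qed.

Lemma ckernel_continuous z : upper_half_plane z ->
  continuous (fun t : R => complex.Re (ckernel z t%:C)) /\
  continuous (fun t : R => complex.Im (ckernel z t%:C)).
Proof.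
move=> zup; have iso (s t : R) : cmod (s%:C - t%:C) = `|s - t|.
  by rewrite -rmorphB cmod_real.
have jk t := jet_kernel 1 (real_neq_upper t zup).
by split=> t; apply: (continuous_path (p := fun t : R => t%:C)) => //;
  [exact: Re_lip|exact: Im_lip].
Qed.

Lemma cauchy_cintegrable z : upper_half_plane z ->
  cintegrable mu I (fun t => (profile t)%:C * ckernel z t%:C).
Proof.
move=> /ckernel_continuous [k1 k2].
have ReE t : complex.Re ((profile t)%:C * ckernel z t%:C) =
    profile t * complex.Re (ckernel z t%:C) by rewrite cReM /= mul0r subr0.
have ImE t : complex.Im ((profile t)%:C * ckernel z t%:C) =
    profile t * complex.Im (ckernel z t%:C) by rewrite cImZ.
split; under eq_fun do rewrite ?ReE ?ImE.
  apply: integrable_continuous => t.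
  by apply: cvgM; [exact: profile_continuous|exact: k1].
apply: integrable_continuous => t.
by apply: cvgM; [exact: profile_continuous|exact: k2].
Qed.

Lemma jump_limit z : upper_half_plane z -> forall e, 0 < e ->
  exists delta : R, 0 < delta /\ forall eps, 0 < eps -> eps < delta ->
    cmod (jump tau d f eps z - cauchy_transform z) < e.
Proof.
move=> zup e e0; have [k1 k2] := ckernel_continuous zup.
have e20 : 0 < e / 2 by rewrite divr_gt0.
have [r1 [r10 P1]] := weak_limit k1 e20.
have [r2 [r20 P2]] := weak_limit k2 e20.
exists (Num.min r1 r2); split; first by rewrite lt_min r10.
move=> eps eps0; rewrite lt_min => /andP[/(P1 _ eps0) h1 /(P2 _ eps0) h2].
rewrite (le_lt_trans (cmod_le_ReIm _)) // [ltRHS]splitr ltrD //.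
  move: h1; rewrite cReD cReN /=; congr (`|_ - _| < _);
    apply: eq_Rintegral => t _.
    by rewrite cReM /= mul0r subr0.
  by rewrite cReM /= mul0r subr0.
move: h2; rewrite cImD cImN /=; congr (`|_ - _| < _);
  apply: eq_Rintegral => t _; by rewrite cImZ.
Qed.

(** The Lipschitz bound of [local_representation] does not depend on [eps], so it
    survives the limit [eps -> 0], in which weak convergence replaces
    [Im f(t + i eps) dt] by the Nevanlinna measure. *)
Lemma boundary_representation :
  (forall z, upper_half_plane z -> jet 4 f z) ->
  (forall z, upper_half_plane z -> closed_upper_half_plane (f z)) ->
  exists2 L, 0 <= L & forall z z', upper_half_plane z -> upper_half_plane z' ->
    cmod (z - tau%:C) < d / 2 -> cmod (z' - tau%:C) < d / 2 ->
    cmod ((corner tau d z * f z * winding tau d z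
             - 2 * 'i%C * cauchy_transform z) -
          (corner tau d z' * f z' * winding tau d z'
             - 2 * 'i%C * cauchy_transform z')) <= L * cmod (z - z').
Proof.
move=> fj fI; have [L L0 LP] := local_representation tau d0 fj fI.
exists L => // z z' zup zup' hz hz'.
pose S eps u := corner tau d u * f (u + 0 +i* eps) * winding tau d u
  - 2 * 'i%C * jump tau d f eps u.
pose H u := corner tau d u * f u * winding tau d u
  - 2 * 'i%C * cauchy_transform u.
have lim u : upper_half_plane u -> forall e, 0 < e ->
    exists delta : R, 0 < delta /\ forall eps, 0 < eps -> eps < delta ->
      cmod (S eps u - H u) < e.
  move=> uup e e0; pose B := cmod (corner tau d u * winding tau d u) + 1.
  have B0 : 0 < B by rewrite ltr_wpDl ?cmod_ge0.
  have [|r [r0 rP]] := jet_cvg (jetW (isT : (1 <= 4)%N) (fj u uup)) (e := e / 2 / B).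
    by rewrite !divr_gt0.
  have [|r' [r'0 r'P]] := jump_limit uup (e := e / 4); first by rewrite divr_gt0.
  exists (Num.min r r'); split; first by rewrite lt_min r0.
  move=> eps eps0; rewrite lt_min => /andP[er er'].
  have -> : S eps u - H u =
      (corner tau d u * winding tau d u) * (f (u + 0 +i* eps) - f u) -
      2 * 'i%C * (jump tau d f eps u - cauchy_transform u).
    by rewrite /S /H; ring.
  rewrite (le_lt_trans (cmod_triangleB _ _)) // [ltRHS]splitr ltrD //.
    have h : cmod (f (u + 0 +i* eps) - f u) < e / 2 / B.
      apply: rP; rewrite addrC addKr (_ : 0 +i* eps = 'i%C * eps%:C).
        by rewrite cmodM cmodi mul1r cmod_real gtr0_norm.
      by apply: complex_eq; rewrite ?cReM ?cImM /=; ring.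
    rewrite cmodM.
    have := ler_wpM2l (cmod_ge0 (corner tau d u * winding tau d u)) (ltW h).
    move=> /le_lt_trans; apply; rewrite mulrCA -[ltRHS]mulr1 ltr_pM2l ?divr_gt0 //.
    by rewrite ltr_pdivrMr // mul1r /B ltrDl.
  have := r'P _ eps0 er'; rewrite !cmodM cmodi mulr1.
  have -> : cmod (2 : R[i]) = 2.
    by rewrite -(rmorph_nat (@real_complex R)) cmod_real gtr0_norm.
  by move=> h; lra.
apply/ler_addgt0Pr => e e0; have e20 : 0 < e / 2 by rewrite divr_gt0.
have [r [r0 rP]] := lim z zup _ e20; have [r' [r'0 r'P]] := lim z' zup' _ e20.
pose eps := Num.min d (Num.min r r') / 2.
have m0 : 0 < Num.min d (Num.min r r') by rewrite !lt_min d0 r0.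
have eps0 : 0 < eps by rewrite divr_gt0.
have : eps < Num.min d (Num.min r r').
  by rewrite ltr_pdivrMr // mulr_natr mulr2n ltrDl.
rewrite !lt_min => /and3P[ed er er'].
have h := LP eps eps0 (ltW ed) z z' zup zup' hz hz'.
have h1 := rP eps eps0 er; have h2 := r'P eps eps0 er'.
rewrite -/(S eps z) -/(S eps z') in h; rewrite -/(H z) -/(H z').
have -> : H z - H z' = (S eps z - S eps z') - (S eps z - H z) + (S eps z' - H z').
  by ring.
have t1 := cmod_triangle (S eps z - S eps z' - (S eps z - H z)) (S eps z' - H z').
have t2 := cmod_triangleB (S eps z - S eps z') (S eps z - H z).
by rewrite (le_trans t1) //; lra.
Qed.

End BoundaryMeasure.

Section LipschitzLimit.
Context {R : realType}.

(** A real function that is Lipschitz near a boundary point extends to it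
    (McShane): the extension is the infimum of [u z + L |z - p|]. *)
Lemma lipschitz_boundary_value (D : set R[i]) (u : R[i] -> R) (p : R[i]) (L : R) :
  0 <= L -> D !=set0 ->
  (forall z z', D z -> D z' -> `|u z - u z'| <= L * cmod (z - z')) ->
  exists l : R, forall z, D z -> `|u z - l| <= L * cmod (z - p).
Proof.
move=> L0 [z0 Dz0] uL; pose A := [set u z + L * cmod (z - p) | z in D].
have lb z : D z -> lbound A (u z - L * cmod (z - p)).
  move=> Dz _ [w Dw <-]; have := uL _ _ Dz Dw; rewrite ler_norml => /andP[_ h].
  have : cmod (z - w) <= cmod (z - p) + cmod (w - p).
    have -> : z - w = (z - p) - (w - p) by ring.
    exact: cmod_triangleB.
  by move=> /(ler_wpM2l L0); lra.
exists (inf A) => z Dz; rewrite ler_norml; apply/andP; split.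
  have : inf A <= u z + L * cmod (z - p).
    by apply: ge_inf; [exists (u z - L * cmod (z - p)); exact: lb|exists z].
  by lra.
have : u z - L * cmod (z - p) <= inf A.
  by apply: lb_le_inf; [exists (u z0 + L * cmod (z0 - p)), z0|exact: lb].
by lra.
Qed.

Lemma lipschitz_boundary_valueC (D : set R[i]) (h : R[i] -> R[i]) (p : R[i]) (L : R) :
  0 <= L -> D !=set0 ->
  (forall z z', D z -> D z' -> cmod (h z - h z') <= L * cmod (z - z')) ->
  exists l : R[i], forall z, D z -> cmod (h z - l) <= 2 * L * cmod (z - p).
Proof.
move=> L0 D0 hL.
have [z z' Dz Dz'|a aP] :=
    @lipschitz_boundary_value D (fun z => complex.Re (h z)) p L L0 D0.
  exact: le_trans (Re_lip _ _) (hL _ _ Dz Dz').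
have [z z' Dz Dz'|b bP] :=
    @lipschitz_boundary_value D (fun z => complex.Im (h z)) p L L0 D0.
  exact: le_trans (Im_lip _ _) (hL _ _ Dz Dz').
exists (a +i* b) => z Dz; rewrite (le_trans (cmod_le_ReIm _)) //.
rewrite cReD cImD cReN cImN /=.
by have := aP z Dz; have := bP z Dz; lra.
Qed.

End LipschitzLimit.

(** * Oscillation of the Cauchy kernel *)

Section KernelEstimates.
Context {R : realType}.
Context (tau C k : R) (gamma : R -> R).
Context (C0 : 0 < C) (k0 : 0 < k).
Implicit Types (z : R[i]) (t a b r : R).

(** [q <= b m] off a small interval around [tau] and [q <= (a + b) m] in it, with
    [m = 1 / gamma(C |t - tau|)], for [q] the variation of the Cauchy kernel
    between [tau] and [z]; the denominators are cleared to cover points where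
    [m] is infinite. *)
Definition kernel_bound z a b r t := 0 < gamma (C * `|t - tau|) ->
  cmod (ckernel z t%:C - ckernel tau%:C t%:C) * gamma (C * `|t - tau|) <=
    if `|t - tau| < r then a + b else b.

Lemma cmod_ckernelB z t : t%:C != z -> t != tau ->
  cmod (ckernel z t%:C - ckernel tau%:C t%:C) =
  cmod (z - tau%:C) / (cmod (t%:C - z) * `|t - tau|).
Proof.
move=> tz tt; rewrite /ckernel.
have h1 : t%:C - z != 0 by rewrite subr_eq0.
have h2 : t%:C - tau%:C != 0 by rewrite -rmorphB -cmod_gt0 cmod_real normr_gt0 subr_eq0.
have -> : (t%:C - z)^-1 - (t%:C - tau%:C)^-1 =
    (z - tau%:C) * ((t%:C - z)^-1 * (t%:C - tau%:C)^-1).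
  by field; rewrite h1 h2.
rewrite !cmodM !cmodV; congr (_ * _).
by rewrite -rmorphB cmod_real invfM.
Qed.

Lemma cmod_ckernelB_le z t : cmod (ckernel z t%:C - ckernel tau%:C t%:C) <=
  (cmod (t%:C - z))^-1 + `|t - tau|^-1.
Proof.
rewrite (le_trans (cmod_triangleB _ _)) // !cmodV.
by rewrite -rmorphB cmod_real.
Qed.

(** In a cone [|t - z|] is comparable to [|t - tau|], because
    [|Re z - tau| <= M Im z <= M |t - z|]. *)
Lemma kernel_bound_cone z M r t : upper_half_plane z -> 0 < M -> 0 < r ->
  `|complex.Re z - tau| <= M * complex.Im z ->
  gamma (C * `|t - tau|) <= k * (C * `|t - tau|) ->
  kernel_bound z ((2 + M) * (k * C)) ((1 + M) * (k * C) * cmod (z - tau%:C) / r) r t.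
Proof.
move=> zup M0 r0 hM; rewrite /kernel_bound; set s := `|t - tau|.
set g := gamma _ => gk g0.
have s0 : 0 < s.
  by rewrite lt_def normr_ge0 andbT; apply/eqP => s0; move: gk; rewrite s0 !mulr0; lra.
have tz := real_neq_upper t zup.
have tt : t != tau by rewrite -subr_eq0 -normr_gt0.
have dz0 : 0 < cmod (t%:C - z) by rewrite cmod_gt0 subr_eq0.
have near_ : s <= (1 + M) * cmod (t%:C - z).
  have h1 := cmodRe (t%:C - z); have h2 := cmodIm (t%:C - z).
  rewrite cReD cReN /= in h1; rewrite cImD cImN /= sub0r normrN in h2.
  have h3 : s <= `|t - complex.Re z| + `|complex.Re z - tau|.
    by rewrite /s (_ : t - tau = (t - complex.Re z) + (complex.Re z - tau));
      [exact: ler_normD|ring].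
  have h4 : M * complex.Im z <= M * cmod (t%:C - z).
    by rewrite ler_wpM2l ?(ltW M0) // (le_trans (ler_norm _)).
  by lra.
have kC0 : 0 < k * C by rewrite mulr_gt0.
have inv : (cmod (t%:C - z))^-1 <= (1 + M) / s.
  by rewrite ler_pdivlMr // mulrC ler_pdivrMr.
have gs : g / s <= k * C.
  by rewrite ler_pdivrMr // -mulrA.
have M1 : 0 < 1 + M by lra.
have rho0 := cmod_ge0 (z - tau%:C).
case: ifPn => [sr|]; last rewrite -leNgt => rs.
  rewrite (@le_trans _ _ ((2 + M) * (k * C))) //; last first.
    by rewrite lerDl divr_ge0 ?(ltW r0) // !mulr_ge0 // ltW.
  apply: (@le_trans _ _ ((2 + M) * (g / s))); last first.
    by rewrite ler_wpM2l //; lra.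
  rewrite mulrCA mulrC ler_wpM2l ?(ltW g0) //.
  rewrite (le_trans (cmod_ckernelB_le _ _)) // -/s.
  have -> : (2 + M) / s = (1 + M) / s + s^-1 by field; rewrite gt_eqF.
  by rewrite lerD2r.
rewrite cmod_ckernelB // -/s.
have -> : cmod (z - tau%:C) / (cmod (t%:C - z) * s) * g =
  cmod (z - tau%:C) * ((cmod (t%:C - z))^-1 * (g / s)).
  by field; rewrite !gt_eqF.
have -> : (1 + M) * (k * C) * cmod (z - tau%:C) / r =
  cmod (z - tau%:C) * ((1 + M) / r * (k * C)) by field; rewrite gt_eqF.
rewrite ler_wpM2l // ler_pM ?invr_ge0 ?cmod_ge0 ?divr_ge0 ?(ltW s0) ?(ltW g0) //.
rewrite (le_trans inv) // ler_wpM2l ?(ltW M1) // lef_pV2 ?posrE //.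
Qed.

(** For [z] in the horocyclic region: when [|t - tau| < 2 |Re z - tau|] the
    height of [z] controls [1 / |t - z|] by [1 / (beta gamma(C |t - tau|))], and
    otherwise [|t - z|] is comparable to [|t - tau|]. *)
Lemma kernel_bound_horocyclic z alpha beta c r t :
  (forall s u, 0 <= s -> s <= u -> gamma s <= gamma u) ->
  upper_half_plane z -> 0 < beta -> 0 < r -> 2 * C <= alpha ->
  beta * gamma (alpha * c) <= complex.Im z -> `|complex.Re z - tau| <= c ->
  cmod (z - tau%:C) < beta^-1 ->
  gamma (C * `|t - tau|) <= k * (C * `|t - tau|) ->
  kernel_bound z (3 * (k * C)) (beta^-1 + 2 * (k * C) / (beta * r)) r t.
Proof.
move=> gincr zup b0 r0 aC hc xc zb; rewrite /kernel_bound; set s := `|t - tau|.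
set g := gamma _ => gk g0.
have s0 : 0 < s.
  by rewrite lt_def normr_ge0 andbT; apply/eqP => s0; move: gk; rewrite s0 !mulr0; lra.
have tz := real_neq_upper t zup.
have tt : t != tau by rewrite -subr_eq0 -normr_gt0.
have dz0 : 0 < cmod (t%:C - z) by rewrite cmod_gt0 subr_eq0.
have h1 := cmodRe (t%:C - z); have h2 := cmodIm (t%:C - z).
rewrite cReD cReN /= in h1; rewrite cImD cImN /= sub0r normrN in h2.
have h3 : s <= `|t - complex.Re z| + `|complex.Re z - tau|.
  by rewrite /s (_ : t - tau = (t - complex.Re z) + (complex.Re z - tau));
    [exact: ler_normD|ring].
have h4 := cmodRe (z - tau%:C); rewrite cReD cReN /= in h4.
set q := cmod (ckernel z _ - _).
have kC0 : 0 < k * C by rewrite mulr_gt0.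
have gs : g / s <= k * C by rewrite ler_pdivrMr // -mulrA.
have gs0 : 0 < g / s by rewrite divr_gt0.
have bi0 : 0 < beta^-1 by rewrite invr_gt0.
have qle : q * g <= (cmod (t%:C - z))^-1 * g + g / s.
  rewrite [g / s]mulrC -mulrDl ler_wpM2r ?(ltW g0) //; exact: cmod_ckernelB_le.
have br0 : 0 < beta * r by rewrite mulr_gt0.
have B0 : 0 <= 2 * (k * C) / (beta * r).
  by rewrite divr_ge0 ?(ltW br0) // mulr_ge0 // ltW.
have [far|near_] := leP (2 * `|complex.Re z - tau|) s.
  have hs : s / 2 <= cmod (t%:C - z) by lra.
  have inv : (cmod (t%:C - z))^-1 <= 2 / s.
    by rewrite ler_pdivlMr // mulrC ler_pdivrMr //; lra.
  case: ifPn => [sr|]; last rewrite -leNgt => rs.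
    have : (cmod (t%:C - z))^-1 * g <= 2 * (g / s).
      by rewrite mulrCA mulrC ler_wpM2l ?(ltW g0).
    by lra.
  have : q * g <= 2 * (k * C) / (beta * r); last by lra.
  rewrite /q cmod_ckernelB // -/s.
  have -> : cmod (z - tau%:C) / (cmod (t%:C - z) * s) * g =
    cmod (z - tau%:C) * ((cmod (t%:C - z))^-1 * (g / s)).
    by field; rewrite !gt_eqF.
  have -> : 2 * (k * C) / (beta * r) = beta^-1 * (2 / r * (k * C)).
    by field; rewrite !gt_eqF.
  have i0 : 0 <= (cmod (t%:C - z))^-1 by rewrite invr_ge0 cmod_ge0.
  have gs0' := ltW gs0; apply: ler_pM; rewrite ?cmod_ge0 ?(ltW zb) //.
    exact: mulr_ge0.
  apply: ler_pM => //.
  by rewrite (le_trans inv) // ler_wpM2l // lef_pV2 ?posrE.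
have gb : beta * g <= cmod (t%:C - z).
  have : g <= gamma (alpha * c).
    apply: gincr; first by rewrite mulr_ge0 // ltW.
    apply: (@le_trans _ _ (C * (2 * c))); first by rewrite ler_wpM2l ?(ltW C0) //; lra.
    rewrite mulrA (mulrC C) ler_wpM2r //.
    exact: le_trans (normr_ge0 _) xc.
  move=> /(ler_wpM2l (ltW b0)) h.
  by rewrite (le_trans h) // (le_trans hc) // (le_trans (ler_norm _)).
have gz : (cmod (t%:C - z))^-1 * g <= beta^-1.
  by rewrite mulrC ler_pdivrMr // mulrC ler_pdivlMr // mulrC.
have sb : s < 2 / beta by rewrite mulrC in near_ *; lra.
case: ifPn => [sr|]; last rewrite -leNgt => rs; first by lra.
have : k * C <= 2 * (k * C) / (beta * r); last by lra.
rewrite ler_pdivlMr // mulrC ler_wpM2r ?(ltW kC0) //.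
have := le_lt_trans rs sb; rewrite ltr_pdivlMr // mulrC => /ltW; exact.
Qed.

End KernelEstimates.

(** * Oscillation of the Cauchy transform under regularity *)

Section RegularityEstimate.
Context {R : realType}.
Context (mu : {measure set (measurableTypeR R) -> \bar R}).
Context (tau d C k : R) (gamma : R -> R).
Context (d0 : 0 < d) (C0 : 0 < C) (k0 : 0 < k).

Let profile (t : R) := d ^+ 2 - (t - tau) ^+ 2.
Let I : set (measurableTypeR R) := [set` `[tau - d, tau + d]].

Let mI : measurable I. Proof. exact: measurable_itv. Qed.

Let weight (t : measurableTypeR R) : \bar R :=
  ((gamma (C * `|t - tau|))%:E^-1)%E.

Context (gamma_ge0 : forall t, 0 <= t -> 0 <= gamma t).
Context (gammak : forall t, I t -> gamma (C * `|t - tau|) <= k * (C * `|t - tau|)).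
Context (weight_int : mu.-integrable I weight).

Let weight_ge0 t : (0 <= weight t)%E.
Proof. by rewrite inve_ge0 lee_fin gamma_ge0 // mulr_ge0 // ltW. Qed.

Let mweight : measurable_fun I weight.
Proof. exact: measurable_int weight_int. Qed.

Let weight_tau : weight tau = +oo%E.
Proof.
have It : I tau.
  by rewrite /I /= in_itv /= gerBl lerDl (ltW d0).
have := gammak It; rewrite /weight inver subrr normr0 !mulr0 => g0.
by rewrite (le_anti (introT andP (conj g0 (gamma_ge0 (lexx 0))))) eqxx.
Qed.

(** Where [gamma] vanishes the weight is infinite, and [0 < a] keeps the product
    infinite. *)
Lemma le_weight (q a t : R) : 0 < a ->
  (0 < gamma (C * `|t - tau|) -> q * gamma (C * `|t - tau|) <= a) ->
  (q%:E <= a%:E * weight t)%E.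
Proof.
move=> a0 h; rewrite /weight inver; case: eqVneq => g0.
  by rewrite mulry gtr0_sg // mul1e leey.
rewrite -EFinM lee_fin ler_pdivlMr; last first.
  by rewrite lt_def g0 gamma_ge0 // mulr_ge0 // ltW.
by apply: h; rewrite lt_def g0 gamma_ge0 // mulr_ge0 // ltW.
Qed.

Let mball (r : R) : measurable (ball tau r : set (measurableTypeR R)).
Proof. exact: measurable_ball. Qed.

Let mrestr r : measurable_fun I (weight \_ (ball tau r)).
Proof.
by apply/(measurable_restrict _ (mball r) mI); apply: measurable_funS mweight.
Qed.

(** The weight is infinite at [tau], which therefore carries no mass; dominated
    convergence applies to the restrictions to shrinking intervals. *)
Lemma weight_small (e : R) : 0 < e ->
  exists2 r : R, 0 < r & (\int[mu]_(t in I) (weight \_ (ball tau r)) t <= e%:E)%E.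
Proof.
move=> e0; pose rr n : R := n.+1%:R^-1.
have [||_ _] := dominated_convergence mI (fun n => mrestr (rr n))
    (measurable_cst 0%E) _ weight_int _.
- apply: filterS (integrable_ae mI weight_int) => x hx Ix.
  have [xt|xt] := eqVneq x tau; first by move: (hx Ix); rewrite xt weight_tau.
  have x0 : 0 < `|tau - x| by rewrite normr_gt0 subr_eq0 eq_sym.
  apply: cvg_near_cst.
  have [N _ NP] := near_infty_natSinv_lt (PosNum x0).
  exists N => // n /NP /= h; rewrite patchE memNset //.
  by rewrite /ball /= => /(lt_trans h); rewrite ltxx.
- apply: aeW => x n Ix; rewrite patchE; case: ifP => _.
    by rewrite gee0_abs.
  by rewrite abse0.
rewrite integral0 => /fine_cvgP [fin /cvgrPdist_lt /(_ e e0)].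
move=> near_; have [N _ NP] : \forall n \near \oo,
    (\int[mu]_(t in I) (weight \_ (ball tau (rr n))) t <= e%:E)%E.
  near=> n; have h1 : (\int[mu]_(t in I) (weight \_ (ball tau (rr n))) t)%E
      \is a fin_num by near: n.
  have : `|0 - fine (\int[mu]_(t in I) (weight \_ (ball tau (rr n))) t)| < e.
    by near: n.
  rewrite sub0r normrN => /(le_lt_trans (ler_norm _)) /ltW h2.
  by rewrite -(fineK h1) lee_fin.
by exists (rr N); [rewrite invr_gt0|exact: (NP N (leqnn N))].
Unshelve. all: by end_near. Qed.

Let profile_le_cst t : `|profile t| <= d ^+ 2 \/ ~ I t.
Proof.
have [It|] := pselect (I t); last by right.
left; rewrite ger0_norm; last exact: profile_ge0.
exact: profile_le.
Qed.

Let measurable_inv : measurable_fun setT (fun t : measurableTypeR R => (t - tau)^-1).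
Proof.
have o : open (~` [set tau] : set R).
  exact/closed_openC/accessible_closed_set1/hausdorff_accessible/Rhausdorff.
rewrite -(setUv [set tau]); apply/measurable_funU; [by []|exact: measurableC|].
split; first exact: measurable_fun_set1.
apply: open_continuous_measurable_fun => // t /set_mem tt.
apply: cvgV; last by apply: cvgB; [exact: cvg_id|exact: cvg_cst].
by rewrite subr_eq0; apply/eqP.
Qed.

(** The linear bound on [gamma] gives [1 / |t - tau| <= k C weight t], so the
    Cauchy transform converges absolutely at [tau] itself. *)
Lemma cauchy_boundary_cintegrable :
  cintegrable mu I (fun t => (profile t)%:C * ckernel tau%:C t%:C).
Proof.
have kE (t : R) : (profile t)%:C * ckernel tau%:C t%:C = (profile t * (t - tau)^-1)%:C.
  by rewrite /ckernel -rmorphB -fmorphV -rmorphM.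
have int : mu.-integrable I (EFin \o (fun t => profile t * (t - tau)^-1)).
  apply: (@le_integrable _ _ _ mu I mI _ (fun t => (d ^+ 2 * (k * C))%:E * weight t)%E).
  - apply/measurable_EFinP; apply: measurable_funM.
      apply: measurable_funTS; apply: continuous_measurable_fun.
      exact: profile_continuous.
    exact: measurable_funTS.
  - move=> t It; have d2 : 0 < d ^+ 2 by rewrite exprn_gt0.
    have kC : 0 < k * C by rewrite mulr_gt0.
    rewrite [leRHS]gee0_abs; last first.
      by rewrite mule_ge0 // lee_fin ltW // mulr_gt0.
    rewrite /= EFinM -muleA normrM EFinM.
    apply: lee_pmul; rewrite ?lee_fin //.
      by have [] := profile_le_cst t.
    apply: le_weight => // g0; have := gammak It.
    set s := `|t - tau| in g0 *; rewrite normfV -/s => gs.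
    have s0 : 0 < s.
      rewrite lt_def normr_ge0 andbT; apply/eqP => s0; move: g0 gs.
      by rewrite s0 !mulr0 => /lt_le_trans h /h; rewrite ltxx.
    by rewrite mulrC ler_pdivrMr // -mulrA.
  - exact: integrableZl.
split.
  by apply: (eq_integrable mI _ _ _ int) => t _; rewrite /comp kE.
apply: (eq_integrable mI (cst 0%E)); last exact: integrable0.
by move=> t _; rewrite /comp kE.
Qed.

(** The pointwise bound integrates to a multiple of the total weight, whose factor
    [b] is small for [z] close to [tau], and a multiple of the weight near [tau],
    which is small by [weight_small]. *)
Lemma transform_estimate (f : R[i] -> R[i]) z (a b r e : R) :
  is_nevanlinna_measure f mu -> upper_half_plane z -> 0 < a -> 0 < b ->
  (forall t, I t -> kernel_bound tau C gamma z a b r t) ->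
  (\int[mu]_(t in I) (weight \_ (ball tau r)) t <= e%:E)%E ->
  cmod (cauchy_transform mu tau d z - cauchy_transform mu tau d tau%:C) <=
    2 * (d ^+ 2 * (b * fine (\int[mu]_(t in I) weight t)%E + a * e)).
Proof.
move=> mu_f zup a0 b0 kb he.
have fin := integrable_fin_num mI weight_int.
have iz := cauchy_cintegrable mu_f tau d zup.
have it := cauchy_boundary_cintegrable.
rewrite /cauchy_transform -cintB //.
pose K t := ((d ^+ 2)%:E * (b%:E * weight t + a%:E * (weight \_ (ball tau r)) t))%E.
have r_ge0 t : (0 <= (weight \_ (ball tau r)) t)%E.
  by rewrite patchE; case: ifP.
have mK1 : measurable_fun I (fun t => b%:E * weight t)%E by exact: measurable_funeM.
have mK2 : measurable_fun I (fun t => a%:E * (weight \_ (ball tau r)) t)%E.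
  exact: measurable_funeM.
have mK : measurable_fun I K.
  by apply: measurable_funeM; exact: emeasurable_funD.
have b0' : (0 <= b%:E)%E by rewrite lee_fin ltW.
have a0' : (0 <= a%:E)%E by rewrite lee_fin ltW.
have d0' : (0 <= (d ^+ 2)%:E)%E by rewrite lee_fin sqr_ge0.
have hK t : I t -> ((cmod ((profile t)%:C * ckernel z t%:C -
    (profile t)%:C * ckernel tau%:C t%:C))%:E <= K t)%E.
  move=> It; rewrite -mulrBr cmodM cmod_real EFinM; apply: lee_pmul.
  - by rewrite lee_fin.
  - by rewrite lee_fin cmod_ge0.
  - by have [|//] := profile_le_cst t; rewrite lee_fin.
  have := kb t It; rewrite /kernel_bound patchE.
  have bE : (t \in (ball tau r : set R)) = (`|t - tau| < r).
    by rewrite distrC; apply/idP/idP => [/set_mem //|h]; apply/mem_set.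
  rewrite bE; case: ifP => _ h.
    rewrite -ge0_muleDl // -EFinD (addrC b); apply: le_weight => //.
    by rewrite addr_gt0.
  by rewrite (_ : point = 0%E) // mule0 adde0; exact: le_weight.
rewrite -lee_fin (le_trans (cmod_cint_le mI (cintegrableB mI iz it) mK hK)) //.
have -> : (\int[mu]_(t in I) K t = (d ^+ 2)%:E * (b%:E * \int[mu]_(t in I) weight t
    + a%:E * \int[mu]_(t in I) (weight \_ (ball tau r)) t))%E.
  rewrite /K ge0_integralZl //; last 2 first.
  - exact: emeasurable_funD.
  - by move=> t It; rewrite adde_ge0 // mule_ge0.
  rewrite ge0_integralD //; last 2 first.
  - by move=> t It; rewrite mule_ge0.
  - by move=> t It; rewrite mule_ge0.
  by rewrite !ge0_integralZl.
rewrite -[X in (b%:E * X)%E]fineK // (EFinM 2) lee_wpmul2l ?lee_fin //.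
rewrite (EFinM (d ^+ 2)) lee_wpmul2l // EFinD EFinM leeD // EFinM.
exact: lee_wpmul2l.
Qed.

End RegularityEstimate.

(** * Boundary values *)

Section BoundaryValue.
Context {R : realType}.

Lemma cmod2i : cmod (2 * 'i%C : R[i]) = 2.
Proof.
rewrite cmodM cmodi mulr1 -(rmorph_nat (@real_complex R)) cmod_real.
by rewrite gtr0_norm.
Qed.

(** Dividing the boundary representation by [corner * winding], which is
    Lipschitz near [tau] and nonzero there, leaves the oscillation of the Cauchy
    transform as the only obstruction to continuity at [tau]. *)
Lemma boundary_value (f : R[i] -> R[i])
  (mu : {measure set (measurableTypeR R) -> \bar R}) (tau d : R) : 0 < d ->
  is_nevanlinna_measure f mu ->
  (forall z, upper_half_plane z -> jet 4 f z) ->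
  (forall z, upper_half_plane z -> closed_upper_half_plane (f z)) ->
  exists (w : R[i]) (rho K : R), [/\ 0 < rho, 0 < K &
    forall z, upper_half_plane z -> cmod (z - tau%:C) < rho ->
      cmod (f z - w) <= K * (cmod (z - tau%:C) +
        cmod (cauchy_transform mu tau d z - cauchy_transform mu tau d tau%:C))].
Proof.
move=> d0 mu_f fj fI.
have [L L0 LP] := boundary_representation mu_f tau d0 fj fI.
set T := cauchy_transform mu tau d in LP *.
pose Q z := corner tau d z * winding tau d z.
pose D : set R[i] := [set z | upper_half_plane z /\ cmod (z - tau%:C) < d / 2].
have D0 : D !=set0.
  exists (tau +i* (d / 4)); split; first by rewrite /upper_half_plane /= divr_gt0.
  rewrite (le_lt_trans (cmod_le_ReIm _)) // cReD cReN cImD cImN /=.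
  by rewrite subrr normr0 subr0 add0r gtr0_norm ?divr_gt0 //; lra.
have [|l lP] := @lipschitz_boundary_valueC R D
    (fun z => corner tau d z * f z * winding tau d z - 2 * 'i%C * T z) tau%:C L L0 D0.
  by move=> z z' [h1 h2] [h1' h2']; exact: LP.
have Q0 : Q tau%:C != 0.
  rewrite /Q mulf_neq0 ?winding_neq0 // /corner subrr expr0n subr0.
  by rewrite -cmod_gt0 cmod_real normr_gt0 expf_neq0 // gt_eqF.
have tau_near : cmod (tau%:C - tau%:C) < d / 2.
  by rewrite subrr cmod0 divr_gt0.
pose B := d / 2 * (cmod (winding tau d tau%:C) + 32) + d ^+ 2 * (64 / d) + 1.
have W0 := cmod_ge0 (winding tau d tau%:C).
have B0 : 0 < B.
  rewrite /B ltr_wpDl // addr_ge0 // mulr_ge0 ?sqr_ge0 // ?divr_ge0 ?(ltW d0) //.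
  by rewrite addr_ge0.
have QB z : cmod (z - tau%:C) < d / 2 ->
    cmod (Q z - Q tau%:C) <= B * cmod (z - tau%:C).
  move=> hz; have wl := winding_lip d0 hz tau_near.
  have -> : Q z - Q tau%:C =
      - (z - tau%:C) * ((z - tau%:C) * winding tau d z) +
      (d ^+ 2)%:C * (winding tau d z - winding tau d tau%:C).
    by rewrite /Q /corner; ring.
  have z0 := cmod_ge0 (z - tau%:C).
  have wz : cmod (winding tau d z) <= cmod (winding tau d tau%:C) + 32.
    have := cmod_triangle (winding tau d z - winding tau d tau%:C) (winding tau d tau%:C).
    rewrite subrK => /le_trans; apply; rewrite addrC lerD2l (le_trans wl) //.
    have : 64 / d * cmod (z - tau%:C) <= 64 / d * (d / 2).
      by rewrite ler_wpM2l ?divr_ge0 ?(ltW d0) // ltW.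
    by rewrite (_ : 64 / d * (d / 2) = 32) //; field; rewrite gt_eqF.
  rewrite (le_trans (cmod_triangle _ _)) // !cmodM cmodN cmod_real.
  rewrite ger0_norm ?sqr_ge0 //.
  have p1 : cmod (z - tau%:C) * (cmod (z - tau%:C) * cmod (winding tau d z)) <=
      cmod (z - tau%:C) * (d / 2 * (cmod (winding tau d tau%:C) + 32)).
    by rewrite ler_wpM2l // ler_pM ?cmod_ge0 // ltW.
  have p2 := ler_wpM2l (sqr_ge0 d) wl.
  by rewrite /B; lra.
pose q := cmod (Q tau%:C); have q0 : 0 < q by rewrite cmod_gt0.
pose w := (l + 2 * 'i%C * T tau%:C) / Q tau%:C.
exists w, (Num.min (d / 2) (q / (2 * B))).
pose K := (2 * L + cmod w * B + 2) / (q / 2).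
have w0 := cmod_ge0 w.
have num0 : 0 <= 2 * L + cmod w * B by rewrite addr_ge0 ?mulr_ge0 // ltW.
exists K; split.
- by rewrite lt_min !divr_gt0 ?mulr_gt0.
- by rewrite divr_gt0 ?divr_gt0 // ltr_wpDl.
move=> z zup; rewrite lt_min => /andP[zd zq].
have Qz : q / 2 <= cmod (Q z).
  have h := QB z zd; have h' : B * cmod (z - tau%:C) <= q / 2.
    move: zq; rewrite ltr_pdivlMr ?mulr_gt0 // => /ltW.
    by rewrite ler_pdivlMr //; lra.
  have := cmod_triangle (Q tau%:C - Q z) (Q z).
  by rewrite subrK (cmodB (Q tau%:C)) -/q; lra.
have Qz0 : Q z != 0 by rewrite -cmod_gt0 (lt_le_trans _ Qz) // divr_gt0.
pose N := (corner tau d z * f z * winding tau d z - 2 * 'i%C * T z - l) -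
  w * (Q z - Q tau%:C) + 2 * 'i%C * (T z - T tau%:C).
have fE : f z - w = N / Q z.
  have -> : N = Q z * (f z - w).
    have hl : w * Q tau%:C = l + 2 * 'i%C * T tau%:C by rewrite /w divfK.
    rewrite /N mulrBr hl /Q; ring.
  by rewrite mulrAC divff // mul1r.
set x := cmod (z - tau%:C); set y := cmod (T z - T tau%:C).
have x0 : 0 <= x by exact: cmod_ge0.
have y0 : 0 <= y by exact: cmod_ge0.
have NK : cmod N <= (2 * L + cmod w * B + 2) * (x + y).
  have h1 := lP z (conj zup zd); have h2 := QB z zd.
  have h3 := ler_wpM2l w0 h2.
  rewrite /N (le_trans (cmod_triangle _ _)) //.
  have h4 : cmod (2 * 'i%C * (T z - T tau%:C)) = 2 * y by rewrite cmodM cmod2i.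
  have h5 := cmod_triangleB
    (corner tau d z * f z * winding tau d z - 2 * 'i%C * T z - l)
    (w * (Q z - Q tau%:C)).
  rewrite [cmod (w * _)]cmodM in h5; rewrite h4.
  have h6 := mulr_ge0 num0 y0.
  rewrite /= -/x in h1; rewrite -/x in h3.
  move: h1 h3 h5 h6; set a := cmod _; set b := cmod _ => h1 h3 h5 h6.
  by lra.
rewrite fE cmodM cmodV ler_pdivrMr ?cmod_gt0 //.
rewrite (le_trans NK) // /K.
have -> : (2 * L + cmod w * B + 2) / (q / 2) * (x + y) * cmod (Q z) =
  (2 * L + cmod w * B + 2) * (x + y) * (cmod (Q z) / (q / 2)).
  by field; rewrite gt_eqF.
rewrite ler_peMr //; last by rewrite ler_pdivlMr ?divr_gt0 // mul1r.
exact: mulr_ge0 (addr_ge0 num0 (ler0n _ 2)) (addr_ge0 x0 y0).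
Qed.

Lemma bounded_on_compact (f : R[i] -> R[i]) (x0 x1 y0 y1 : R) :
  (forall z, upper_half_plane z -> jet 4 f z) -> x0 <= x1 -> 0 < y0 -> y0 <= y1 ->
  exists M : R, forall z, in_rect x0 x1 y0 y1 z -> cmod (f z) <= M.
Proof.
move=> fj hx hy0 hy.
have [|z zr zP] := rect_max (v := fun w => cmod (f w)) hx hy.
  move=> z [_ /andP[h _]]; apply: cont_at_cmod; apply: jetW (fj _ _) => //.
  by rewrite /upper_half_plane /=; apply: lt_le_trans h.
by exists (cmod (f z)).
Qed.

Lemma nontangential_limitP (f : R[i] -> R[i]) (tau : R) (w : R[i]) :
  (forall M e : R, 0 < M -> 0 < e -> exists2 rho : R, 0 < rho &
    forall z, upper_half_plane z -> `|complex.Re z - tau| <= M * complex.Im z ->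
      cmod (z - tau%:C) < rho -> cmod (f z - w) < e) ->
  nontangential_limit f tau w.
Proof.
move=> H M M0; apply/cvgrPdist_lt => e.
rewrite ltcE /= => /andP[/eqP eI eR].
have [rho rho0 rhoP] := H M (complex.Re e) M0 eR.
have eE : e = (complex.Re e)%:C by apply: complex_eq => /=; rewrite ?eI.
apply/nbhs_ballP; exists rho%:C; first by rewrite /= ltcR.
move=> z; rewrite /ball /= norm_cmod ltcR cmodB => hz [zup hM].
by rewrite eE norm_cmod ltcR cmodB; exact: rhoP.
Qed.

End BoundaryValue.

(** * Horocyclic continuity *)

Theorem theorem2p11 (R : realType) (f : R[i] -> R[i])
  (f_analytic : analytic_on upper_half_plane f)
  (f_maps : forall z, upper_half_plane z -> closed_upper_half_plane (f z))
  (mu : {measure set (measurableTypeR R) -> \bar R})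
  (mu_f : is_nevanlinna_measure f mu)
  (tau : R) (gamma : R -> R)
  (gamma_ge0 : forall t, 0 <= t -> 0 <= gamma t)
  (gamma_incr : monotone_increasing gamma)
  (gamma_neq0 : exists2 t, 0 <= t & gamma t != 0)
  (gamma_O : bigO_id_at0 gamma)
  (f_regular : regular_at gamma mu tau) :
  horocyclically_continuous_at gamma f tau.
Proof.
have fj z : upper_half_plane z -> jet 4 f z by exact: analytic_jet f_analytic.
have [C C0 [U [nU mU iU]]] := f_regular.
have [k [delta [k0 delta0 gk]]] := gamma_O.
have [t0 t00 gt0] := gamma_neq0.
have {}gt0 : 0 < gamma t0 by rewrite lt_def gt0 gamma_ge0.
have [rU /= rU0 rUP] : exists2 r : R, 0 < r & ball tau r `<=` U.
  by case: nU => r; exists r.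
pose d := Num.min (rU / 2) (delta / (2 * C)).
have d0 : 0 < d by rewrite lt_min !divr_gt0 // mulr_gt0.
pose I : set (measurableTypeR R) := [set` `[tau - d, tau + d]].
have mI : measurable I by exact: measurable_itv.
have Id t : I t -> `|t - tau| <= d.
  by rewrite /I /= in_itv /= ler_norml => /andP[h1 h2]; apply/andP; split; lra.
have IU : I `<=` U.
  move=> t /Id td; apply: rUP; rewrite /ball /= distrC (le_lt_trans td) //.
  rewrite (@le_lt_trans _ _ (rU / 2)) ?ge_min ?lexx //.
  by rewrite ltr_pdivrMr // mulr_natr mulr2n ltrDl.
have gammak t : I t -> gamma (C * `|t - tau|) <= k * (C * `|t - tau|).
  move=> /Id td; apply: gk; first by rewrite mulr_ge0 // ltW.
  have : C * `|t - tau| <= C * (delta / (2 * C)).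
    by rewrite ler_wpM2l ?(ltW C0) // (le_trans td) // ge_min lexx orbT.
  rewrite (_ : C * (delta / (2 * C)) = delta / 2); last by field; rewrite gt_eqF.
  by move=> /le_lt_trans; apply; rewrite ltr_pdivrMr // mulr_natr mulr2n ltrDl.
have wint : mu.-integrable I (fun t => ((gamma (C * `|t - tau|))%:E^-1)%E).
  have mU' : measurable (U : set (measurableTypeR R)) by exact: mU.
  exact: integrableS mU' mI IU iU.
have [w [rho [K [rho0 K0 fw]]]] := boundary_value tau d0 mu_f fj f_maps.
pose Mt := fine (\int[mu]_(t in I) ((gamma (C * `|t - tau|))%:E^-1)%E)%E.
have Mt0 : 0 <= Mt.
  apply: fine_ge0; apply: integral_ge0 => t _.
  by rewrite inve_ge0 lee_fin gamma_ge0 // mulr_ge0 // ltW.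
have small := weight_small d0 C0 gamma_ge0 gammak wint.
(* The two approach regions differ only in the kernel bound supplied here. *)
have est z a b r e : upper_half_plane z -> cmod (z - tau%:C) < rho ->
    0 < a -> 0 < b -> (forall t, I t -> kernel_bound tau C gamma z a b r t) ->
    (\int[mu]_(t in I)
      ((fun t => ((gamma (C * `|t - tau|))%:E^-1)%E) \_ (ball tau r)) t <= e%:E)%E ->
    cmod (f z - w) <= K * (cmod (z - tau%:C) + 2 * (d ^+ 2 * (b * Mt + a * e))).
  move=> zup zr a0 b0 kb he; rewrite (le_trans (fw z zup zr)) //.
  rewrite ler_wpM2l ?(ltW K0) // lerD2l.
  exact: (transform_estimate d0 C0 k0 gamma_ge0 gammak wint mu_f zup a0 b0 kb he).
have kC0 : 0 < k * C by rewrite mulr_gt0.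
have d20 : 0 < d ^+ 2 by rewrite exprn_gt0.
(* [2 * C] is what the kernel estimate requires; the other term makes
   [gamma (alpha * t)] positive from [t = rho / 2] on. *)
pose alpha := 2 * C + 2 * t0 / rho.
have t0r : 0 <= 2 * t0 / rho by rewrite divr_ge0 ?(ltW rho0) // mulr_ge0.
have alphaC : 2 * C <= alpha by rewrite lerDl.
have alpha0 : 0 < alpha by rewrite (lt_le_trans _ alphaC) // mulr_gt0.
have galpha : 0 < gamma (alpha * (rho / 2)).
  apply: lt_le_trans gt0 _; apply: gamma_incr => //.
  have -> : alpha * (rho / 2) = C * rho + t0 by rewrite /alpha; field; rewrite gt_eqF.
  by rewrite lerDr mulr_ge0 // ltW.
have horo beta r e z : 0 < beta -> 0 < r ->
    (\int[mu]_(t in I)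
      ((fun t => ((gamma (C * `|t - tau|))%:E^-1)%E) \_ (ball tau r)) t <= e%:E)%E ->
    stolz (fun t => beta * gamma (alpha * t)) tau z -> disk tau beta^-1 z ->
    cmod (z - tau%:C) < rho ->
    cmod (f z - w) <= K * (1 + 2 * (d ^+ 2 * ((1 + 2 * (k * C) / r) * Mt))) / beta +
      K * (2 * (d ^+ 2 * (3 * (k * C) * e))).
  move=> b0 r0 he [zup [c [c0 hc xc]]] zb zr.
  have bi0 : 0 < beta^-1 by rewrite invr_gt0.
  have kb t : I t -> kernel_bound tau C gamma z (3 * (k * C))
      (beta^-1 + 2 * (k * C) / (beta * r)) r t.
    move=> It.
    exact: (kernel_bound_horocyclic C0 k0 gamma_incr zup b0 r0 alphaC hc xc zb
      (gammak t It)).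
  have a0 : 0 < 3 * (k * C) by rewrite mulr_gt0.
  have B0 : 0 < beta^-1 + 2 * (k * C) / (beta * r).
    by rewrite addr_gt0 // divr_gt0 ?mulr_gt0.
  rewrite (le_trans (est z _ _ r e zup zr a0 B0 kb he)) //.
  have -> : K * (1 + 2 * (d ^+ 2 * ((1 + 2 * (k * C) / r) * Mt))) / beta +
      K * (2 * (d ^+ 2 * (3 * (k * C) * e))) =
      K * (beta^-1 + 2 * (d ^+ 2 * ((beta^-1 + 2 * (k * C) / (beta * r)) * Mt
        + 3 * (k * C) * e))) by field; rewrite !gt_eqF.
  by rewrite ler_wpM2l ?(ltW K0) // lerD2r ltW.
have osc_fin beta : 0 < beta -> (horocyclic_osc gamma f tau w alpha beta < +oo)%E.
  move=> b0; have bi0 : 0 < beta^-1 by rewrite invr_gt0.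
  have [r r0 rP] := small 1 ltr01.
  pose N1 := K * (1 + 2 * (d ^+ 2 * ((1 + 2 * (k * C) / r) * Mt))) / beta +
      K * (2 * (d ^+ 2 * (3 * (k * C) * 1))).
  (* Away from [tau] the region keeps a positive distance from the real axis. *)
  pose eta := Num.min (rho / 2) (beta * gamma (alpha * (rho / 2))).
  have eta0 : 0 < eta by rewrite lt_min divr_gt0 // mulr_gt0.
  have [|||N2 N2P] := @bounded_on_compact R f (tau - beta^-1) (tau + beta^-1)
    eta (eta + beta^-1) fj.
  - by lra.
  - by [].
  - by rewrite lerDl ltW.
  apply: (@le_lt_trans _ _ (Num.max N1 (N2 + cmod w))%:E); last exact: ltry.
  apply: ge_ereal_sup => _ [z [zs zb] <-]; rewrite lee_fin le_max.
  have [near_|far] := ltP (cmod (z - tau%:C)) rho.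
    by apply/orP; left; exact: (horo beta r 1 z).
  apply/orP; right; rewrite (le_trans (cmod_triangleB _ _)) // lerD2r.
  apply: N2P; case: zs => zup [c [c0 hc xc]].
  have z0 : 0 < complex.Im z by [].
  have h1 := cmodRe (z - tau%:C); have h2 := cmodIm (z - tau%:C).
  rewrite cReD cReN /= in h1; rewrite cImD cImN /= subr0 in h2.
  have h3 := cmod_le_ReIm (z - tau%:C).
  rewrite cReD cReN cImD cImN /= subr0 (gtr0_norm z0) in h3.
  have zb' : cmod (z - tau%:C) < beta^-1 by [].
  have etaI : eta <= complex.Im z.
    have [xr|xr] := leP (rho / 2) `|complex.Re z - tau|.
      rewrite ge_min; apply/orP; right; rewrite (le_trans _ hc) //.
      rewrite ler_wpM2l ?(ltW b0) // gamma_incr //.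
        by rewrite mulr_ge0 ?divr_ge0 // ltW.
      by rewrite ler_wpM2l ?(ltW alpha0) // (le_trans xr).
    by rewrite ge_min; apply/orP; left; lra.
  rewrite (gtr0_norm z0) in h2; rewrite ler_norml in h1; case/andP: h1 => h1 h1'.
  by split; apply/andP; split => //; lra.
exists w; split.
  apply: nontangential_limitP => M e M0 e0.
  pose a := (2 + M) * (k * C).
  have a0 : 0 < a by rewrite mulr_gt0 // addr_gt0.
  pose e' := e / (4 * (K * (2 * (d ^+ 2 * a)))).
  have Ka : 0 < K * (2 * (d ^+ 2 * a)).
    by rewrite mulr_gt0 // mulr_gt0 // mulr_gt0.
  have e'0 : 0 < e' by rewrite divr_gt0 // mulr_gt0.
  have [r r0 rP] := small e' e'0.
  pose S := K * (1 + 2 * (d ^+ 2 * ((1 + M) * (k * C) / r * Mt))).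
  have S0 : 0 < S.
    rewrite mulr_gt0 // ltr_pwDl // mulr_ge0 // mulr_ge0 ?(ltW d20) //.
    rewrite mulr_ge0 // divr_ge0 ?(ltW r0) // mulr_ge0 ?(ltW kC0) //.
    by rewrite addr_ge0 // ltW.
  have S20 : 0 < 2 * S by exact: mulr_gt0.
  exists (Num.min rho (e / (2 * S))).
    by rewrite lt_min rho0 divr_gt0.
  move=> z zup zM; rewrite lt_min => /andP[zr ze].
  have z0 : 0 < cmod (z - tau%:C).
    by rewrite cmod_gt0 subr_eq0 eq_sym; exact: real_neq_upper.
  have b0 : 0 < (1 + M) * (k * C) * cmod (z - tau%:C) / r.
    by rewrite divr_gt0 // mulr_gt0 // mulr_gt0 // addr_gt0.
  have kb t : I t -> kernel_bound tau C gamma z a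
      ((1 + M) * (k * C) * cmod (z - tau%:C) / r) r t.
    by move=> It; exact: (kernel_bound_cone C0 k0 zup M0 r0 zM (gammak t It)).
  rewrite (le_lt_trans (est z _ _ r e' zup zr a0 b0 kb rP)) //.
  have -> : K * (cmod (z - tau%:C) + 2 * (d ^+ 2 *
      ((1 + M) * (k * C) * cmod (z - tau%:C) / r * Mt + a * e'))) =
      cmod (z - tau%:C) * S + K * (2 * (d ^+ 2 * a)) * e'.
    by rewrite /S; ring.
  have -> : K * (2 * (d ^+ 2 * a)) * e' = e / 4.
    by rewrite /e'; field; rewrite ?gt_eqF.
  have : cmod (z - tau%:C) * S < e / 2.
    by rewrite ltr_pdivlMr // -mulrA (mulrC S) -ltr_pdivlMr.
  by lra.
exists alpha; split => //.
(* The region meets every disk around [tau], on the vertical line through it: the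
   supremum over an empty set would be [-oo]. *)
have osc_ge0 beta : 0 < beta -> (0 <= horocyclic_osc gamma f tau w alpha beta)%E.
  move=> b0; pose y := (2 * beta)^-1.
  have y0 : 0 < y by rewrite invr_gt0 mulr_gt0.
  pose c := Num.min (delta / (2 * alpha)) (y / (beta * (k * alpha))).
  have c0 : 0 < c.
    by rewrite lt_min !divr_gt0 ?mulr_gt0.
  have ac : alpha * c < delta.
    apply: (@le_lt_trans _ _ (alpha * (delta / (2 * alpha)))).
      by rewrite ler_wpM2l ?(ltW alpha0) // ge_min lexx.
    rewrite (_ : alpha * (delta / (2 * alpha)) = delta / 2); last first.
      by field; rewrite gt_eqF.
    by rewrite ltr_pdivrMr // mulr_natr mulr2n ltrDl.
  apply: (@le_trans _ _ (cmod (f (tau +i* y) - w))%:E).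
    by rewrite lee_fin cmod_ge0.
  apply: ereal_sup_ubound; exists (tau +i* y) => //; split.
    split; first exact: y0.
    exists c; split => //=; last by rewrite subrr normr0 ltW.
    have := gk (alpha * c) (mulr_ge0 (ltW alpha0) (ltW c0)) ac.
    move=> /(ler_wpM2l (ltW b0)) /le_trans; apply.
    have : c <= y / (beta * (k * alpha)) by rewrite ge_min lexx orbT.
    by rewrite ler_pdivlMr ?mulr_gt0 //; lra.
  apply: le_lt_trans (cmod_le_ReIm _) _; rewrite cReD cReN cImD cImN /=.
  rewrite subrr normr0 subr0 add0r gtr0_norm // ltf_pV2 ?posrE ?mulr_gt0 //.
  by rewrite mulrC mulr_natr mulr2n ltrDl.
apply/fine_cvgP; split.
  exists 0; split => // beta b0.
  by rewrite ge0_fin_numE ?osc_ge0 // osc_fin.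
apply/cvgrPdist_le => e e0.
have Kc : 0 < K * (2 * (d ^+ 2 * (3 * (k * C)))).
  by rewrite mulr_gt0 // mulr_gt0 // mulr_gt0 // mulr_gt0.
pose e' := e / (2 * (K * (2 * (d ^+ 2 * (3 * (k * C)))))).
have e'0 : 0 < e' by rewrite divr_gt0 // mulr_gt0.
have [r r0 rP] := small e' e'0.
pose S := K * (1 + 2 * (d ^+ 2 * ((1 + 2 * (k * C) / r) * Mt))).
have S0 : 0 < S.
  rewrite mulr_gt0 // ltr_pwDl // mulr_ge0 // mulr_ge0 ?(ltW d20) // mulr_ge0 //.
  by rewrite addr_ge0 // divr_ge0 ?(ltW r0) // mulr_ge0 // ltW.
exists (Num.max rho^-1 (2 * S / e)); split; first exact: num_real.
move=> beta; rewrite gt_max => /andP[b1 b2].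
have b0 : 0 < beta by rewrite (lt_trans _ b1) // invr_gt0.
have o0 := osc_ge0 beta b0; have ofin := osc_fin beta b0.
rewrite /= sub0r normrN ger0_norm; last exact: fine_ge0.
rewrite -lee_fin fineK; last by rewrite ge0_fin_numE.
apply: ge_ereal_sup => _ [z [zs zb] <-]; rewrite lee_fin.
have zr : cmod (z - tau%:C) < rho.
  have : cmod (z - tau%:C) < beta^-1 by exact: zb.
  move=> /lt_trans; apply.
  by rewrite -[ltRHS]invrK ltf_pV2 ?posrE ?invr_gt0.
rewrite (le_trans (horo beta r e' z b0 r0 rP zs zb zr)) //.
have -> : K * (2 * (d ^+ 2 * (3 * (k * C) * e'))) = e / 2.
  by rewrite /e'; field; rewrite ?gt_eqF.
have : S / beta <= e / 2.
  by move: b2; rewrite ltr_pdivrMr // ler_pdivrMr //; lra.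
by rewrite -/S; lra.
Qed.
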